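(* Let $d=2^n$. Suppose an unknown $n$-qubit channel $\mathcal{C}$ is, with equal probability, either the completely depolarizing channel $\mathcal{D}(\rho)=\mathrm{Tr}(\rho)\,I/d$, or the unitary channel $\mathcal{U}(\rho)=U\rho U^\dagger$ for a single fixed unitary $U$ drawn from the Haar measure on $U(d)$. Any learning algorithm without quantum memory (for channels) that decides which case holds with success probability at least $2/3$ must use $T\ge\Omega(d^{1/3})$ applications of $\mathcal{C}$.
   Context: A learning algorithm without quantum memory for an unknown $n$-qubit channel $\mathcal{C}$, using $T$ applications, proceeds in $T$ rounds, with an auxiliary register of an arbitrary number $n'\ge0$ of qubits: in each round it chooses (depending arbitrarily on all previously observed classical outcomes) a pure state $|\phi\rangle$ on $n+n'$ qubits and a POVM $\{F_s\}_s$ on $n+n'$ qubits, applies $\mathcal{C}$ to the first $n$ qubits (i.e. forms $(\mathcal{C}\otimes\mathrm{id})(|\phi\rangle\langle\phi|)$), and observes outcome $s$ with probability $\mathrm{Tr}\big(F_s(\mathcal{C}\otimes\mathrm{id})(|\phi\rangle\langle\phi|)\big)$; no quantum state is retained between rounds. Its final output is an arbitrary function of the classical outcomes. *)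

(* Defs.v *)
From HB Require Import structures.
From mathcomp Require Import all_boot all_order all_algebra.
From mathcomp Require Import complex mxtens.
From mathcomp Require Import all_classical all_reals all_analysis.

Set Implicit Arguments.
Unset Strict Implicit.
Unset Printing Implicit Defensive.

Import Order.TTheory GRing.Theory Num.Theory.
Import numFieldTopology.Exports numFieldNormedType.Exports.

Local Open Scope ring_scope.
Local Open Scope classical_set_scope.
Local Open Scope sesquilinear_scope.

Section QuantumLearning.
Variable R : realType.
Local Notation C := (R[i]).

(* Borel measurable space on d x d complex matrices.                  *)
(* The carrier 'M[C^o]_d is (convertible to) 'M[C]_d, equipped with   *)
(* the entrywise (product) topology of C; MB d is its Borel sigma-    *)
(* algebra (generated by the open sets).                              *)
Definition MB (d : nat) := g_sigma_algebraType (@open 'M[C^o]_(d, d)).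
Definition toC (d : nat) (M : MB d) : 'M[C]_d := M.
Definition ofC (d : nat) (M : 'M[C]_d) : MB d := M.

Definition unitary_set (d : nat) : set (MB d) := [set M | toC M \is unitarymx].

(* mu is the Haar (probability) measure on U(d): a probability measure *)
(* on the Borel sets, supported on U(d), and invariant under left     *)
(* multiplication by every unitary V (this characterises the Haar    *)
(* measure uniquely).                                                 *)
Definition haar_prob (d : nat) (mu : probability (MB d) R) : Prop :=
  mu (@unitary_set d) = 1%E /\
  forall V : 'M[C]_d, V \is unitarymx ->
    forall A : set (MB d), measurable A ->
      mu ((fun M : MB d => ofC (V *m toC M)) @^-1` A) = mu A.

Definition depolarizing (d : nat) (X : 'M[C]_d) : 'M[C]_d :=
  (\tr X / d%:R)%:M.

Definition unitary_channel (d : nat) (U : 'M[C]_d) (X : 'M[C]_d) : 'M[C]_d :=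
  U *m X *m U ^t*.

(* (Phi (x) id) on the system (x) auxiliary space, C^d (x) C^e, with  *)
(* the tensor product realised by mxtens (Kronecker product):          *)
(* rho = \sum_{a,b} rho_{ab} (x) E_{ab}  |->  \sum_{a,b} Phi(rho_{ab}) (x) E_{ab}. *)
Definition tens_id (d e : nat) (Phi : 'M[C]_d -> 'M[C]_d)
    (rho : 'M[C]_(d * e)) : 'M[C]_(d * e) :=
  \sum_(a < e) \sum_(b < e)
     (Phi (\matrix_(i, j) rho (mxtens_index (i, a)) (mxtens_index (j, b)))
        *t (delta_mx a b : 'M[C]_e)).

Definition unit_vector (D : nat) (psi : 'cV[C]_D) : Prop :=
  psi ^t* *m psi = 1%:M.

Definition density (D : nat) (psi : 'cV[C]_D) : 'M[C]_D := psi *m psi ^t*.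

Definition psd (D : nat) (F : 'M[C]_D) : Prop :=
  forall v : 'cV[C]_D, 0 <= (v ^t* *m F *m v) 0 0.

Definition is_povm (D K : nat) (F : 'I_K -> 'M[C]_D) : Prop :=
  (forall s, psd (F s)) /\ \sum_(s < K) F s = 1%:M.

(* Learning algorithms without quantum memory.                          *)
(* n system qubits, n' auxiliary qubits, outcomes in 'I_K.              *)
(* In each round, the input pure state and the POVM are arbitrary       *)
(* functions of the history (sequence of previous outcomes); the final *)
(* answer is an arbitrary function of the whole transcript              *)
(* (true = "the channel is the unitary channel").                      *)
Record algo (n n' K : nat) := Algo {
  alg_state : seq 'I_K -> 'cV[C]_(2 ^ n * 2 ^ n');
  alg_povm  : seq 'I_K -> 'I_K -> 'M[C]_(2 ^ n * 2 ^ n');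
  alg_out   : seq 'I_K -> bool }.

Definition algo_valid (n n' K : nat) (A : algo n n' K) : Prop :=
  forall h : seq 'I_K,
    unit_vector (alg_state A h) /\ is_povm (alg_povm A h).

Definition transcript_prob (n n' K T : nat) (A : algo n n' K)
    (Phi : 'M[C]_(2 ^ n) -> 'M[C]_(2 ^ n)) (tr : T.-tuple 'I_K) : C :=
  \prod_(t < T)
    \tr (alg_povm A (take t tr) (tnth tr t)
         *m tens_id Phi (density (alg_state A (take t tr)))).

Definition output_prob (n n' K T : nat) (A : algo n n' K)
    (Phi : 'M[C]_(2 ^ n) -> 'M[C]_(2 ^ n)) (b : bool) : C :=
  \sum_(tr : T.-tuple 'I_K | alg_out A tr == b) transcript_prob A Phi tr.

Definition success_prob (n n' K T : nat) (A : algo n n' K)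
    (mu : probability (MB (2 ^ n)) R) : \bar R :=
  ((2^-1 : R) * complex.Re (output_prob T A (@depolarizing (2 ^ n)) false))%:E
  + ((2^-1 : R)%:E *
     \int[mu]_(M in @unitary_set (2 ^ n))
        (complex.Re (output_prob T A (unitary_channel (toC M)) true))%:E)%E.

End QuantumLearning.

(* Main.v *)
Require Import Defs.
From HB Require Import structures.
From mathcomp Require Import all_boot all_order all_algebra.
From mathcomp Require Import complex mxtens.
From mathcomp Require Import all_classical all_reals all_analysis.
From mathcomp Require Import measurable_realfun ring lra.
Import Order.TTheory GRing.Theory Num.Theory.
Import numFieldTopology.Exports numFieldNormedType.Exports.
Local Open Scope ring_scope.

(** A rank-one POVM element [|f><f|] applied to [(U (x) 1)|phi>] has probability
    [|tr (U A)|^2] with [A] the partial contraction of [phi] with [f], against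
    [|A|^2 / d] for the depolarizing channel, where [|A|] is the Frobenius norm.
    The theorem therefore reduces to the bound
      [E prod_(t < T) |tr (U A_t)|^2 >= prod_(t < T) |A_t|^2 / (d + t)],
    which makes every transcript at least [prod_t d / (d + t) >= 1 - T^2 / d]
    times as likely under a Haar unitary as under depolarization; this even
    gives [T >= Omega(d^(1/2))].

    For a homogeneous polynomial [g] of degree [T + 1] in the entries of [U],
    invariance of the Haar measure identifies [E |grad g|^2] with [E conj(g) Cg],
    where the Casimir operator [C] is [d (T + 1)] plus the sum of all swaps of
    the row indices of two letters.  [C] commutes with the positive moment
    matrix and is at most [(T + 1) (d + T)], so that
    [E |g|^2 >= E |grad g|^2 / ((T + 1) (d + T))].  Iterating, [E |g|^2] dominates
    the Fock norm of [g] divided by [prod_t (d + t)], and the Fock norm of a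
    product of linear forms is at least the product of their norms since
    creation operators satisfy [a a^* = a^* a + 1]. *)

Set Implicit Arguments.
Unset Strict Implicit.
Unset Printing Implicit Defensive.

(** * Words and the Fock form *)

Section Words.
Variable X : finType.

Definition word T := {ffun 'I_T -> X}.

Definition ins T (s : 'I_T.+1) (x : X) (u : word T) : word T.+1 :=
  [ffun t => oapp u x (unlift s t)].

Definition del T (s : 'I_T.+1) (w : word T.+1) : word T :=
  [ffun t => w (lift s t)].

Lemma ins_at T (s : 'I_T.+1) x u : ins s x u s = x.
Proof. by rewrite ffunE unlift_none. Qed.

Lemma ins_lift T (s : 'I_T.+1) x u t : ins s x u (lift s t) = u t.
Proof. by rewrite ffunE liftK. Qed.

Lemma insK T (s : 'I_T.+1) x u : del s (ins s x u) = u.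
Proof. by apply/ffunP => t; rewrite ffunE ins_lift. Qed.

Lemma delK T (s : 'I_T.+1) (w : word T.+1) : ins s (w s) (del s w) = w.
Proof.
apply/ffunP => t; rewrite ffunE; case: unliftP => [t' ->|->] //=.
by rewrite ffunE.
Qed.

Lemma ins_lift0 T (s : 'I_T.+1) y z (u : word T) :
  ins (lift ord0 s) y (ins ord0 z u) = ins ord0 z (ins s y u).
Proof.
apply/ffunP => t; case: (unliftP ord0 t) => [t' ->|->]; last first.
  rewrite ins_at ffunE; case: unliftP => [t' Et|/eqP]; last first.
    by rewrite (negPf (neq_lift _ _)).
  have -> : t' = ord0.
    by apply/val_inj; move/(congr1 val): Et; rewrite /= /bump;
      case: (val t') => // n; rewrite addnS.
  by rewrite /= ins_at.
rewrite ins_lift !ffunE; case: (unliftP s t') => [t'' ->|->] /=; last first.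
  by rewrite unlift_none.
have -> : lift ord0 (lift s t'') = lift (lift ord0 s) (lift ord0 t'').
  apply/val_inj; rewrite /= /bump /= !add1n ltnS.
  by case: leqP => _; rewrite ?addn0 ?add0n ?add1n.
by rewrite liftK /= ins_lift.
Qed.

Lemma big_word (R : Type) (idx : R) (op : Monoid.com_law idx) T (s : 'I_T.+1)
    (F : word T.+1 -> R) :
  \big[op/idx]_w F w = \big[op/idx]_x \big[op/idx]_u F (ins s x u).
Proof.
rewrite pair_big /=.
rewrite (reindex (fun p : X * word T => ins s p.1 p.2)) //=.
exists (fun w : word T.+1 => (w s, del s w)) => [[x u] _|w _] /=.
  by rewrite ins_at insK.
by rewrite delK.
Qed.

End Words.

(** * Annihilation operators, multiplication by a linear form, and the Fock form *)

Section Fock.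
Variables (C : numClosedFieldType) (X : finType).
Local Notation word := (word X).
Local Notation "x ^*" := (Num.conj x).

(** Reading [v] as the coefficients of the polynomial [\sum_w v w * \prod_t X_(w t)], this is the
    partial derivative in [X_x]. Summing over all insertion positions makes it depend only on the
    symmetric part of [v], so tensors need not be symmetrized. *)
Definition ann T (x : X) (v : word T.+1 -> C) (u : word T) : C :=
  \sum_s v (ins s x u).

(** On polynomials, multiplication by the linear form [l]: the creation operator, left
    unsymmetrized. *)
Definition tens T (l : X -> C) (f : word T -> C) (w : word T.+1) : C :=
  l (w ord0) * f (del ord0 w).

(** Unfolded, it pairs all [T]-fold derivatives of [f] and [g]; it equals [T!] times the Fischer
    inner product of the two polynomials. *)
Fixpoint fock T : (word T -> C) -> (word T -> C) -> C :=
  match T with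
  | 0 => fun f g => \sum_w (f w)^* * g w
  | T'.+1 => fun f g => \sum_x fock (ann x f) (ann x g)
  end.

Lemma fockS T (f g : word T.+1 -> C) :
  fock f g = \sum_x fock (ann x f) (ann x g).
Proof. by []. Qed.

(** Separates the insertion at the front from those into the tail, which drives the inductions on
    the length. *)
Lemma ann_ins0 T x (v : word T.+2 -> C) z u :
  ann x v (ins ord0 z u) =
  v (ins ord0 x (ins ord0 z u)) + ann x (fun w => v (ins ord0 z w)) u.
Proof.
rewrite /ann big_ord_recl; congr (_ + _).
by apply: eq_bigr => s _; rewrite ins_lift0.
Qed.

Lemma word0_eq (u w : word 0) : u = w.
Proof. by apply/ffunP => -[]. Qed.

Lemma annD T x (f g : word T.+1 -> C) u :
  ann x (fun w => f w + g w) u = ann x f u + ann x g u.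
Proof. by rewrite /ann big_split. Qed.

(** Partial derivatives commute. With the first letter [z] split off, the terms that insert [x] or
    [y] at the front are symmetric in [x] and [y], and the rest is the induction hypothesis on the
    tail. *)
Lemma annC T x y (v : word T.+2 -> C) : ann x (ann y v) = ann y (ann x v).
Proof.
apply/funext; elim: T v => [|T IH] v u.
  rewrite /ann !big_ord_recl !big_ord0 !addr0.
  rewrite !(ins_lift0 (ord0 : 'I_1)).
  by rewrite addrC.
have [z [u' ->]] : exists z u', u = ins ord0 z u'.
  by exists (u ord0), (del ord0 u); rewrite delK.
rewrite !ann_ins0.
rewrite (_ : (fun w => ann y v (ins ord0 z w)) =
  (fun w => v (ins ord0 y (ins ord0 z w)) +
     ann y (fun w => v (ins ord0 z w)) w)); last first.
  by apply/funext => w; rewrite ann_ins0.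
rewrite (_ : (fun w => ann x v (ins ord0 z w)) =
  (fun w => v (ins ord0 x (ins ord0 z w)) +
     ann x (fun w => v (ins ord0 z w)) w)); last first.
  by apply/funext => w; rewrite ann_ins0.
rewrite !annD IH; ring.
Qed.

Lemma ann_tens0 x l (f : word 0 -> C) : ann x (tens l f) = (fun u => l x * f u).
Proof.
apply/funext => u; rewrite /ann big_ord_recl big_ord0 addr0 /tens ins_at.
by rewrite insK.
Qed.

(** Leibniz rule for a linear form times a polynomial, that is, the canonical commutation
    relation. *)
Lemma ann_tens T x l (f : word T.+1 -> C) :
  ann x (tens l f) = (fun u => l x * f u + tens l (ann x f) u).
Proof.
apply/funext => u; rewrite -[u in LHS](delK ord0) ann_ins0 /tens ins_at insK delK.
congr (_ + _); rewrite /ann mulr_sumr; apply: eq_bigr => s _.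
by rewrite ins_at insK.
Qed.

Lemma ann_sum T (I : finType) x (c : I -> C) (F : I -> word T.+1 -> C) :
  ann x (fun w => \sum_i c i * F i w) = (fun u => \sum_i c i * ann x (F i) u).
Proof.
apply/funext => u; rewrite /ann exchange_big /=; apply: eq_bigr => i _.
by rewrite mulr_sumr.
Qed.

Lemma fock_sumr T (I : finType) (c : I -> C) g (F : I -> word T -> C) :
  fock g (fun w => \sum_i c i * F i w) = \sum_i c i * fock g (F i).
Proof.
elim: T g F => [|T IH] g F /=.
  under eq_bigr do rewrite mulr_sumr; rewrite exchange_big /=.
  by apply: eq_bigr => i _; rewrite mulr_sumr; apply: eq_bigr => w _; rewrite mulrCA.
under eq_bigr do rewrite ann_sum IH; rewrite exchange_big /=.
by apply: eq_bigr => i _; rewrite mulr_sumr.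
Qed.

Lemma fock_conj T (f g : word T -> C) : (fock f g)^* = fock g f.
Proof.
elim: T f g => [|T IH] f g /=; rewrite rmorph_sum /=.
  by apply: eq_bigr => w _; rewrite rmorphM /= conjCK mulrC.
by apply: eq_bigr => x _; rewrite IH.
Qed.

Lemma fock_suml T (I : finType) (c : I -> C) g (F : I -> word T -> C) :
  fock (fun w => \sum_i c i * F i w) g = \sum_i (c i)^* * fock (F i) g.
Proof.
rewrite -fock_conj fock_sumr rmorph_sum; apply: eq_bigr => i _.
by rewrite rmorphM /= fock_conj.
Qed.

Lemma fockDr T (f g h : word T -> C) (c : C) :
  fock f (fun w => c * g w + h w) = c * fock f g + fock f h.
Proof.
have -> : (fun w => c * g w + h w) =
    (fun w => \sum_(b : bool) (if b then c else 1) * (if b then g else h) w).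
  by apply/funext => w; rewrite big_bool /= mul1r.
by rewrite fock_sumr big_bool /= mul1r.
Qed.

Lemma fockZr T (f g : word T -> C) (c : C) :
  fock f (fun w => c * g w) = c * fock f g.
Proof.
have -> : (fun w => c * g w) = (fun w => \sum_(b : 'I_1) c * g w).
  by apply/funext => w; rewrite big_ord1.
by rewrite fock_sumr big_ord1.
Qed.

Lemma fockDl T (f g h : word T -> C) (c : C) :
  fock (fun w => c * g w + h w) f = c^* * fock g f + fock h f.
Proof. by rewrite -fock_conj fockDr rmorphD rmorphM /= !fock_conj. Qed.

Lemma fockZl T (f g : word T -> C) (c : C) :
  fock (fun w => c * g w) f = c^* * fock g f.
Proof. by rewrite -fock_conj fockZr rmorphM /= !fock_conj. Qed.

Lemma fock_ge0 T (f : word T -> C) : 0 <= fock f f.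
Proof.
elim: T f => [|T IH] f /=; apply: sumr_ge0 => // w _.
by rewrite mulrC mul_conjC_ge0.
Qed.

(** Adjointness of creation and annihilation. The factor [T.+1] is the ratio of the normalizations
    [T.+1!] and [T!] of [fock] in the two degrees. *)
Lemma fock_tensr T l g (f : word T -> C) :
  fock g (tens l f) = T.+1%:R * \sum_y l y * fock (ann y g) f.
Proof.
elim: T g f => [|T IH] g f.
  by rewrite mul1r fockS; apply: eq_bigr => x _; rewrite ann_tens0 fockZr.
rewrite fockS.
under eq_bigr do rewrite ann_tens fockDr IH.
rewrite big_split /= -mulr_sumr exchange_big /=.
under [X in _ + _ * X]eq_bigr do rewrite -mulr_sumr.
have -> : \sum_i l i * \sum_j fock (ann i (ann j g)) (ann j f) =
   \sum_i l i * fock (ann i g) f.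
  by apply: eq_bigr => i _; congr (_ * _); apply: eq_bigr => j _; rewrite annC.
by rewrite -[T.+2%:R]natr1 mulrDl mul1r addrC.
Qed.

(** Moving one creation operator across turns the right side into [f] paired with [a a^* f].
    Commuting gives the left side plus the term of [a^* a], which is nonnegative. *)
Lemma fock_tens_ge T l (f : word T -> C) :
  T.+1%:R * (\sum_x l x * (l x)^*) * fock f f <= fock (tens l f) (tens l f).
Proof.
rewrite fock_tensr -mulrA ler_pM2l ?ltr0Sn //.
case: T f => [|T] f.
  rewrite mulr_suml ler_sum // => x _; rewrite ann_tens0.
  by rewrite fockZl mulrA.
have -> : \sum_y l y * fock (ann y (tens l f)) f =
   \sum_y l y * (l y)^* * fock f f + \sum_y l y * fock (tens l (ann y f)) f.
  rewrite -big_split; apply: eq_bigr => y _; rewrite ann_tens.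
  by rewrite fockDl mulrDr mulrA.
rewrite -mulr_suml lerDl.
have -> : \sum_y l y * fock (tens l (ann y f)) f =
   T.+1%:R * fock (fun w => \sum_y (l y)^* * ann y f w)
                 (fun w => \sum_y (l y)^* * ann y f w).
  rewrite fock_suml mulr_sumr; apply: eq_bigr => y _.
  rewrite conjCK mulrCA; congr (_ * _).
  rewrite -fock_conj fock_tensr rmorphM rmorph_nat rmorph_sum fock_sumr /=.
  by congr (_ * _); apply: eq_bigr => z _; rewrite rmorphM /= fock_conj.
by rewrite mulr_ge0 ?fock_ge0.
Qed.

Lemma fock_prod_ge T (L : 'I_T -> X -> C) :
  T`!%:R * \prod_t (\sum_x L t x * (L t x)^*) <=
  fock (fun w : word T => \prod_t L t (w t)) (fun w => \prod_t L t (w t)).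
Proof.
elim: T L => [|T IH] L.
  rewrite fact0 mul1r big_ord0 /=.
  rewrite (big_pred1 [ffun i : 'I_0 => match notF (valP i) with end]).
    by rewrite big_ord0 conjC1 mulr1.
  by move=> w; apply/esym/eqP/word0_eq.
have -> : (fun w : word T.+1 => \prod_t L t (w t)) =
   tens (L ord0) (fun w : word T => \prod_t L (lift ord0 t) (w t)).
  apply/funext => w; rewrite big_ord_recl /tens; congr (_ * _).
  by apply: eq_bigr => t _; rewrite ffunE.
apply: le_trans (fock_tens_ge _ _); rewrite big_ord_recl factS natrM -!mulrA.
rewrite ler_pM2l ?ltr0Sn // mulrCA; apply: ler_wpM2l; last exact: IH.
by apply: sumr_ge0 => x _; rewrite mul_conjC_ge0.
Qed.

End Fock.

(** * Positive semidefinite matrices and kernels *)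

Local Open Scope sesquilinear_scope.

Section Psd.
Variable C : numClosedFieldType.

Definition possemi n (B : 'M[C]_n) := forall v : 'cV[C]_n, 0 <= (v ^t* *m B *m v) 0 0.

Lemma trmxC_delta n (i : 'I_n) :
  (delta_mx i 0 : 'cV[C]_n) ^t* = delta_mx 0 i.
Proof. by apply/matrixP => k l; rewrite !mxE rmorph_nat andbC. Qed.

Lemma quad_form n (B : 'M[C]_n) (v : 'cV[C]_n) :
  (v ^t* *m B *m v) 0 0 = \sum_i \sum_j (v i 0)^* * B i j * v j 0.
Proof.
rewrite mxE exchange_big /=; apply: eq_bigr => j _; rewrite mxE mulr_suml.
by apply: eq_bigr => i _; rewrite !mxE.
Qed.

(** Polarization: testing on [e_i + c e_j] with [c = 1] and [c = 'i] shows that [B i j + B j i] and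
    ['i * (B i j - B j i)] are real, which determines the conjugate of [B j i]. *)
Lemma possemi_herm n (B : 'M[C]_n) : possemi B -> B = B ^t*.
Proof.
move=> pB; apply/matrixP => i j; rewrite !mxE.
have q2 (c : C) : 0 <= B i i + c * B i j + c^* * B j i + c * c^* * B j j.
  have := pB (delta_mx i 0 + c *: delta_mx j 0).
  have -> : (delta_mx i 0 + c *: delta_mx j 0) ^t* =
      delta_mx 0 i + c^* *: delta_mx 0 j :> 'rV_n.
    by apply/matrixP => k l;
      rewrite !mxE rmorphD rmorphM /= !rmorph_nat !(andbC (l == _)).
  rewrite !(mulmxDl, mulmxDr) -!(scalemxAl, scalemxAr).
  rewrite -!rowE -!colE !mxE.
  by congr (0 <= _); ring.
have q1 : B i i \is Num.real.
  by have := q2 0; rewrite conjC0 !mul0r !addr0 => /ger0_real.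
have q3 : B j j \is Num.real.
  have := pB (delta_mx j 0).
  rewrite trmxC_delta -rowE -colE !mxE; exact: ger0_real.
have r1 : B i j + B j i \is Num.real.
  have /ger0_real := q2 1; rewrite conjC1 !mul1r.
  rewrite (_ : _ + _ + _ + _ = B i j + B j i + (B i i + B j j)); last by ring.
  by rewrite rpredDr // rpredD.
have r2 : 'i * (B i j - B j i) \is Num.real.
  have /ger0_real := q2 'i; rewrite conjCi mulrN -expr2 sqrCi opprK mul1r.
  rewrite (_ : _ + _ + _ + _ = 'i * (B i j - B j i) + (B i i + B j j)); last by ring.
  by rewrite rpredDr // rpredD.
move/CrealP: r1; move/CrealP: r2.
rewrite rmorphM rmorphB rmorphD /= conjCi => e1 e2.
have e3 : (B i j)^* - (B j i)^* = B j i - B i j.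
  apply: (mulfI (neq0Ci C)); rewrite -[LHS]opprK -mulNr e1; ring.
have : 2 * (B j i)^* = 2 * B i j.
  transitivity ((B i j)^* + (B j i)^* - ((B i j)^* - (B j i)^*)); first by ring.
  rewrite e2 e3; ring.
have n2 : 2 != 0 :> C by rewrite pnatr_eq0.
by move/(mulfI n2).
Qed.

Lemma possemi_spectral n (B : 'M[C]_n) : possemi B ->
  exists P : 'M[C]_n, exists D : 'rV[C]_n,
    [/\ P \is unitarymx, forall i, 0 <= D 0 i & B = P ^t* *m diag_mx D *m P].
Proof.
move=> pB; have hB := possemi_herm pB.
have /hermitian_normalmx/orthomx_spectralP eB : B \is hermsymmx.
  by apply/is_hermitianmxP; rewrite expr0 scale1r.
move: eB; have := spectral_unitarymx B.
move: (spectralmx B) (spectral_diag B) => P D uP; rewrite invmx_unitary // => eB.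
exists P, D; split => // i.
have := pB (P ^t* *m delta_mx i 0).
rewrite trmx_mul map_mxM trmxCK eB !mulmxA mulmxtVK // -!mulmxA.
rewrite (mulmxA P) (unitarymxP uP) mul1mx trmxC_delta.
by rewrite mulmxA -rowE -colE !mxE eqxx.
Qed.

(** [A] commutes with the square root of [B] as well, so the product is the congruence of [A] by
    that square root. The proof works in an eigenbasis [P] of [B]. *)
Lemma possemi_comm n (A B : 'M[C]_n) : possemi A -> possemi B ->
  A *m B = B *m A -> possemi (A *m B).
Proof.
move=> pA pB AB v; have [P [D [uP D0 eB]]] := possemi_spectral pB.
have PP := mulmx1C (unitarymxP uP).
have [A' eA'] : {A' : 'M[C]_n | A' = P *m A *m P ^t*} by eexists.
pose S := diag_mx (map_mx sqrtC D).
have AD : A' *m diag_mx D = diag_mx D *m A'.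
  have e : P *m B = diag_mx D *m P by rewrite eB !mulmxA (unitarymxP uP) mul1mx.
  have e' : B *m P ^t* = P ^t* *m diag_mx D.
    by rewrite eB mulmxtVK.
  by rewrite eA' -mulmxA -e' !mulmxA -e -!(mulmxA P) AB.
(* Where [A' i j] is nonzero, commutation forces [D 0 i = D 0 j], so this eigenvalue is the product
   of the two square roots. *)
have ADS : A' *m diag_mx D = S *m A' *m S.
  apply/matrixP => i j; move/matrixP/(_ i j): AD.
  rewrite mul_mx_diag mul_diag_mx mul_mx_diag mul_diag_mx !mxE.
  have [->|nz] := eqVneq (A' i j) 0; first by rewrite !(mulr0, mul0r).
  rewrite mulrC => /(mulIf nz) <-.
  by rewrite mulrAC -expr2 sqrtCK mulrC.
pose w := P ^t* *m S *m P *m v.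
have -> : v ^t* *m (A *m B) *m v = w ^t* *m A *m w.
  have -> : A *m B = P ^t* *m (A' *m diag_mx D) *m P.
    by rewrite eA' eB !mulmxA PP mul1mx.
  have wS : w ^t* = v ^t* *m P ^t* *m S *m P.
    rewrite /w !trmx_mul !map_mxM trmxCK !mulmxA; congr (_ *m _ *m _).
    apply/matrixP => i j; rewrite !mxE eq_sym.
    case: eqVneq => [->|_]; rewrite ?mulr0n ?rmorph0 // !mulr1n.
    by apply: geC0_conj; rewrite sqrtC_ge0.
  by rewrite ADS wS /w eA' !mulmxA.
exact: pA.
Qed.

Definition possemi_kernel (W : finType) (K : W -> W -> C) :=
  forall v : W -> C, 0 <= \sum_w \sum_z (v w)^* * K w z * v z.

(** Moments are indexed by words rather than ordinals; this enumeration only serves to carry the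
    spectral argument over to kernels. *)
Definition kernel_mx (W : finType) (K : W -> W -> C) : 'M[C]_#|W| :=
  \matrix_(i, j) K (enum_val i) (enum_val j).

Lemma possemi_kernelP (W : finType) (K : W -> W -> C) :
  possemi (kernel_mx K) <-> possemi_kernel K.
Proof.
have sumE (F : W -> C) : \sum_w F w = \sum_(i < #|W|) F (enum_val i).
  by rewrite -[RHS](big_enum_val (A := W)).
have E (v : W -> C) (u : 'cV[C]_#|W|) : (forall i, u i 0 = v (enum_val i)) ->
    (u ^t* *m kernel_mx K *m u) 0 0 = \sum_w \sum_z (v w)^* * K w z * v z.
  move=> uv; rewrite quad_form sumE; apply: eq_bigr => i _; rewrite sumE.
  by apply: eq_bigr => j _; rewrite mxE !uv.
split=> [pK v|pK u].
  by rewrite -(E v (\col_i v (enum_val i))) // => i; rewrite mxE.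
by rewrite (E (fun w => u (enum_rank w) 0)) // => i; rewrite enum_valK.
Qed.

Lemma possemi_kernel_herm (W : finType) (K : W -> W -> C) :
  possemi_kernel K -> forall w z, (K w z)^* = K z w.
Proof.
move=> /possemi_kernelP/possemi_herm/matrixP H w z.
by have := H (enum_rank z) (enum_rank w); rewrite !mxE !enum_rankK => <-.
Qed.

Lemma possemi_kernel_comm (W : finType) (K L : W -> W -> C) :
  possemi_kernel K -> possemi_kernel L ->
  (forall w z, \sum_y K w y * L y z = \sum_y L w y * K y z) ->
  possemi_kernel (fun w z => \sum_y K w y * L y z).
Proof.
move=> /possemi_kernelP pK /possemi_kernelP pL KL; apply/possemi_kernelP.
have sumE (F : W -> C) : \sum_w F w = \sum_(i < #|W|) F (enum_val i).
  by rewrite -[RHS](big_enum_val (A := W)).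
have mulE (K' L' : W -> W -> C) : kernel_mx K' *m kernel_mx L' =
    kernel_mx (fun w z => \sum_y K' w y * L' y z).
  apply/matrixP => i j; rewrite !mxE sumE.
  by apply: eq_bigr => k _; rewrite !mxE.
rewrite -mulE; apply: possemi_comm => //; rewrite !mulE.
by apply/matrixP => i j; rewrite !mxE KL.
Qed.

End Psd.

(** * Moments of an invariant mean on the unitary group *)

(** The moment computation sees the Haar measure only through these properties. [nice] stands for a
    class of integrable functions closed under polynomial operations; values are compared on unitary
    matrices alone, where the measure lives. *)
Record haar_mean (C : numClosedFieldType) (d : nat)
    (nice : ('M[C]_d -> C) -> Prop) (E : ('M[C]_d -> C) -> C) : Prop := HaarMean {
  hm_cst : forall c, nice (fun=> c);
  hm_coord : forall i j, nice (fun U => U i j);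
  hm_add : forall F G, nice F -> nice G -> nice (fun U => F U + G U);
  hm_mul : forall F G, nice F -> nice G -> nice (fun U => F U * G U);
  hm_conj : forall F, nice F -> nice (fun U => (F U)^*);
  hm_one : E (fun=> 1) = 1;
  hm_lin : forall c F G, nice F -> nice G ->
    E (fun U => c * F U + G U) = c * E F + E G;
  hm_ext : forall F G, (forall U, U \is unitarymx -> F U = G U) -> E F = E G;
  hm_ge0 : forall F, nice F -> (forall U, U \is unitarymx -> 0 <= F U) -> 0 <= E F;
  hm_inv : forall F V, nice F -> V \is unitarymx ->
    E (fun U => F (V *m U)) = E F }.


(** * Tools for differentiating the invariance: first-order coefficients and the span of
    projections *)

Lemma sum_card1 (V : nmodType) (I : finType) (F : {set I} -> V) :
  \sum_(J : {set I} | #|J| == 1%N) F J = \sum_i F [set i].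
Proof.
rewrite -(@big_imset _ _ _ _ _ (fun i : I => [set i]) predT F) /=; last first.
  by move=> i j _ _ /set1_inj.
apply: eq_bigl => J; apply/cards1P/imsetP => [[i ->]|[i _ ->]]; by exists i.
Qed.

(** The condition on [e] says [|1 + e| = 1], which has infinitely many solutions. Two polynomials in
    [e] that agree there coincide, and the claim compares their coefficients of degree one. *)
Lemma sum_expr_card1 (C : numClosedFieldType) (I : finType) (a b : {set I} -> C) :
  (forall e : C, e + e^* + e * e^* = 0 ->
     \sum_(J : {set I}) e ^+ #|J| * a J = \sum_(J : {set I}) e ^+ #|J| * b J) ->
  \sum_i a [set i] = \sum_i b [set i].
Proof.
move=> H; pose p : {poly C} := \sum_(J : {set I}) (a J - b J) *: 'X^#|J|.
(* For nonzero [e], [|1 + e| = 1] means that [- e^-1] has real part 1/2; integer imaginary parts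
   give distinct solutions. *)
pose e (k : nat) : C := - (2^-1 + k%:R * 'i)^-1.
have re k : 2^-1 + k%:R * 'i != 0 :> C.
  apply/eqP => h; have := congr1 Num.conj h.
  rewrite rmorph0 rmorphD rmorphM /= conjCi fmorphV !rmorph_nat => h'.
  have : 1 = 0 :> C by rewrite -[RHS]addr0 -{1}h -h'; field.
  by move/eqP; rewrite oner_eq0.
have he k : e k + (e k)^* + e k * (e k)^* = 0.
  rewrite /e rmorphN fmorphV rmorphD rmorphM /= conjCi fmorphV !rmorph_nat.
  have r := re k; have r' : 2^-1 + k%:R * - 'i != 0 :> C.
    rewrite -(conjC_eq0 (_ + _)) rmorphD rmorphM rmorphN /= conjCi fmorphV !rmorph_nat.
    by rewrite opprK.
  have : 2^-1 + k%:R * 'i + (2^-1 + k%:R * - 'i) = 1 :> C by field.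
  move: r r'; move: (2^-1 + _) (2^-1 + _) => x y nx ny xy.
  transitivity ((1 - (y + x)) / (x * y)); first by field; rewrite nx ny.
  by rewrite xy subrr mul0r.
have ie : injective e.
  move=> k l /oppr_inj/invr_inj/addrI/(mulIf (neq0Ci C))/eqP.
  by rewrite eqr_nat => /eqP.
have p0 : p = 0.
  apply/eqP; apply: contraT => np.
  have := @max_poly_roots _ p [seq e k | k <- iota 0 (size p)] np.
  rewrite (map_inj_uniq ie) iota_uniq size_map size_iota ltnn => -> //.
  apply/allP => _ /mapP[k _ ->]; rewrite rootE horner_sum; apply/eqP.
  under eq_bigr do rewrite hornerZ hornerXn mulrBl mulrC [b _ * _]mulrC.
  by rewrite sumrB H ?subrr.
have : p`_1 = 0 by rewrite p0 coef0.
rewrite coef_sum.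
under eq_bigr do rewrite coefZ coefXn eq_sym mulr_natr mulrb.
rewrite -big_mkcond /= sum_card1 sumrB => /eqP; rewrite subr_eq0 => /eqP //.
Qed.


(** Orthogonal projections span all matrices. Those on basis vectors detect the diagonal of [G];
    those on [e_a + z e_b] with [z = 1] and [z = 'i] separate [G a b] from [G b a]. *)
Lemma proj_span (C : numClosedFieldType) d (G : 'M[C]_d) :
  (forall P : 'M[C]_d, P ^t* = P -> P *m P = P -> \tr (P *m G) = 0) -> G = 0.
Proof.
move=> H; apply/matrixP => b a; rewrite [RHS]mxE.
have trd i j : \tr (delta_mx i j *m G) = G j i.
  rewrite /mxtrace (bigD1 i) //= big1 => [|k /negPf ki].
    by rewrite addr0 mxE (bigD1 j) //= big1 ?addr0 ?mxE ?eqxx ?mul1r // => k /negPf kj;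
      rewrite mxE kj andbF mul0r.
  by rewrite mxE big1 // => l _; rewrite mxE ki mul0r.
have dC (i j : 'I_d) : (delta_mx i j : 'M[C]_d) ^t* = delta_mx j i.
  by apply/matrixP => k l; rewrite !mxE rmorph_nat andbC.
have Gd i : G i i = 0 by rewrite -trd H // mul_delta_mx.
have [->//|nab] := eqVneq b a.
have Pz (z : C) : z * z^* = 1 -> z^* * G b a + z * G a b = 0.
  move=> zz.
  (* [Q] is [v v^*] for [v = e_a + z e_b], a vector of squared norm 2, so [Q / 2] is a
     projection. *)
  pose Q : 'M[C]_d := delta_mx a a + delta_mx b b +
    z^* *: delta_mx a b + z *: delta_mx b a.
  have QC : Q ^t* = Q.
    rewrite /Q !linearD !linearZ /= !map_mxD !map_mxZ !dC /= conjCK.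
    by rewrite -!addrA; congr (_ + (_ + _)); rewrite addrC.
  have QQ : Q *m Q = Q + Q.
    rewrite /Q !(mulmxDl, mulmxDr) -!(scalemxAl, scalemxAr) !mul_delta_mx_cond !eqxx.
    rewrite (negPf nab) eq_sym (negPf nab) !mulr1n !mulr0n !scaler0 !addr0 !add0r.
    rewrite !scalerA zz [z^* * z]mulrC zz !scale1r.
    by apply/matrixP => k l; rewrite !mxE; ring.
  have HH : \tr ((2^-1 *: Q) *m G) = 2^-1 * (z^* * G b a + z * G a b).
    rewrite -scalemxAl mxtraceZ /Q !mulmxDl -!scalemxAl !mxtraceD !mxtraceZ !trd.
    by rewrite !Gd !add0r.
  have n2 : 2^-1 != 0 :> C by rewrite invr_eq0 pnatr_eq0.
  apply: (mulfI n2); rewrite mulr0 -HH; apply: H.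
    by rewrite linearZ /= map_mxZ QC fmorphV rmorph_nat.
  rewrite -scalemxAr -scalemxAl QQ scalerA -mulr2n -[Q *+ 2]scaler_nat scalerA.
  by congr (_ *: _); field.
have e1 : G b a + G a b = 0.
  by have := Pz 1; rewrite conjC1 !mul1r; apply.
have e2 : G b a - G a b = 0.
  have := Pz 'i; rewrite conjCi mulrN -expr2 sqrCi opprK => /(_ erefl) e.
  by apply: (mulfI (neq0Ci C)); rewrite mulr0 -oppr0 -e; ring.
have n2 : 2 != 0 :> C by rewrite pnatr_eq0.
apply: (mulfI n2); rewrite mulr0.
by rewrite -[RHS]addr0 -{1}e1 -e2; ring.
Qed.

(** * Monomials in the entries of a unitary matrix and their moments *)

Section Moments.
Variables (C : numClosedFieldType) (d : nat).
Variables (nice : ('M[C]_d -> C) -> Prop) (E : ('M[C]_d -> C) -> C).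
Hypothesis hE : haar_mean nice E.
Local Notation X := ('I_d * 'I_d)%type.
Local Notation word := (word X).

Lemma nice_sum (I : Type) (r : seq I) (P : pred I) (F : I -> 'M[C]_d -> C) :
  (forall i, nice (F i)) -> nice (fun U => \sum_(i <- r | P i) F i U).
Proof.
move=> nF; elim: r => [|i r IH].
  by under eq_fun do rewrite big_nil; exact: hm_cst hE 0.
under eq_fun do rewrite big_cons.
by case: (P i) => //; apply: (hm_add hE).
Qed.

Lemma nice_prod (I : Type) (r : seq I) (P : pred I) (F : I -> 'M[C]_d -> C) :
  (forall i, nice (F i)) -> nice (fun U => \prod_(i <- r | P i) F i U).
Proof.
move=> nF; elim: r => [|i r IH].
  by under eq_fun do rewrite big_nil; exact: hm_cst hE 1.
under eq_fun do rewrite big_cons.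
by case: (P i) => //; apply: (hm_mul hE).
Qed.

Lemma nice_mulmx (A : 'M[C]_d) i j : nice (fun U => (A *m U) i j).
Proof.
under eq_fun do rewrite mxE; apply: nice_sum => k.
by apply: (hm_mul hE); [exact: (hm_cst hE)|exact: (hm_coord hE)].
Qed.

Lemma mean0 : E (fun=> 0) = 0.
Proof.
have := hm_lin hE 1 (hm_cst hE 0) (hm_cst hE 0).
under eq_fun do rewrite mul1r addr0.
by rewrite mul1r => /eqP; rewrite -subr_eq0 opprD addrA subrr sub0r oppr_eq0 => /eqP.
Qed.

Lemma mean_sum (I : finType) (c : I -> C) (F : I -> 'M[C]_d -> C) :
  (forall i, nice (F i)) ->
  E (fun U => \sum_i c i * F i U) = \sum_i c i * E (F i).
Proof.
move=> nF; elim: (index_enum I) => [|i r IH].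
  by under eq_fun do rewrite big_nil; rewrite big_nil mean0.
under eq_fun do rewrite big_cons.
rewrite (hm_lin hE) ?IH ?big_cons //; apply: nice_sum => j.
by apply: (hm_mul hE) => //; exact: (hm_cst hE).
Qed.

Definition mono T (w : word T) (U : 'M[C]_d) : C := \prod_t U (w t).1 (w t).2.

(** The part of [mono w ((1 + e A) U)] that takes the perturbation exactly at the positions in [J].
    Summed over singletons, it is the derivation induced by [A] on monomials. *)
Definition mix T (A : 'M[C]_d) (J : {set 'I_T}) (w : word T) (U : 'M[C]_d) : C :=
  \prod_t (if t \in J then A *m U else U) (w t).1 (w t).2.

Lemma nice_mix T A J (w : word T) : nice (mix A J w).
Proof.
apply: nice_prod => t; case: (t \in J); [exact: nice_mulmx|exact: (hm_coord hE)].
Qed.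

Lemma nice_mono T (w : word T) : nice (mono w).
Proof. by apply: nice_prod => t; exact: (hm_coord hE). Qed.

Lemma mono_pencil T (w : word T) A e U :
  mono w ((1%:M + e *: A) *m U) = \sum_(J : {set 'I_T}) e ^+ #|J| * mix A J w U.
Proof.
rewrite /mono (eq_bigr (fun t => e * (A *m U) (w t).1 (w t).2
   + U (w t).1 (w t).2)); last first.
  by move=> t _; rewrite mulmxDl mul1mx -scalemxAl [LHS]mxE [X in _ + X]mxE addrC.
rewrite bigA_distr; apply: eq_bigr => J _.
rewrite (eq_bigr (fun t => (if t \in J then e else 1) *
   (if t \in J then A *m U else U) (w t).1 (w t).2)); last first.
  by move=> t _; case: ifP; rewrite ?mul1r.
by rewrite big_split /= -big_mkcond prodr_const.
Qed.

Definition mom T (w w' : word T) : C := E (fun U => (mono w U)^* * mono w' U).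

(* Differentiating the invariance of [E] along the unitaries [1 + e P], where
   [|1 + e| = 1]. *)
Lemma mean_derivation_proj T (P : 'M[C]_d) (w w' : word T) :
  P ^t* = P -> P *m P = P ->
  \sum_t E (fun U => (mono w U)^* * mix P [set t] w' U) =
  \sum_t E (fun U => (mix P [set t] w U)^* * mono w' U).
Proof.
move=> hP PP.
pose a J := E (fun U => (mono w U)^* * mix P J w' U).
pose b J := E (fun U => (mix P J w U)^* * mono w' U).
apply: (@sum_expr_card1 C _ a b) => e he.
pose V := 1%:M + e *: P.
have hV : V ^t* = 1%:M + e^* *: P.
  by rewrite /V linearD linearZ /= map_mxD map_mxZ hP trmx1 map_mx1.
have VV : V *m V ^t* = 1%:M.
  rewrite hV /V mulmxDl !mulmxDr !mul1mx mulmx1 -!scalemxAl -!scalemxAr PP scalerA.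
  by rewrite -addrA -!scalerDl addrA [e^* + e]addrC he scale0r addr0.
have uV : V \is unitarymx by apply/unitarymxP.
have Vu : V ^t* *m V = 1%:M by exact: mulmx1C VV.
rewrite /a /b.
have n1 J : nice (fun U => (mono w U)^* * mix P J w' U).
  by apply: (hm_mul hE); [apply: (hm_conj hE); exact: nice_mono|exact: nice_mix].
have n2 J : nice (fun U => (mix P J w U)^* * mono w' U).
  by apply: (hm_mul hE); [apply: (hm_conj hE); exact: nice_mix|exact: nice_mono].
rewrite -!mean_sum //.
(* Inserting [V ^t* *m V = 1] into the conjugated factor and replacing [V *m U] by [U] moves the
   perturbation from one factor to the other; conjugation turns the [e^*] of [V ^t*] back into
   [e]. *)
transitivity (E (fun U => (mono w (V ^t* *m (V *m U)))^* * mono w' (V *m U))).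
  apply: (hm_ext hE) => U _; rewrite mulmxA Vu mul1mx mono_pencil mulr_sumr.
  by apply: eq_bigr => J _; rewrite mulrCA.
rewrite (hm_inv hE (F := fun U => (mono w (V ^t* *m U))^* * mono w' U)) //.
  apply: (hm_ext hE) => U _; rewrite hV mono_pencil rmorph_sum mulr_suml.
  by apply: eq_bigr => J _; rewrite rmorphM rmorphXn /= conjCK mulrA.
apply: (hm_mul hE); last exact: nice_mono.
by apply: (hm_conj hE); apply: nice_prod => t; exact: nice_mulmx.
Qed.

Lemma mono_ins T (s : 'I_T.+1) x (u : word T) U :
  mono (ins s x u) U = U x.1 x.2 * mono u U.
Proof.
rewrite /mono (bigD1_ord s) //= ins_at; congr (_ * _).
by apply: eq_bigr => t _; rewrite ins_lift.
Qed.

(** Left multiplication acts on row indices only, so the column index is kept. Deleting and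
    reinserting the letter exposes it as a factor of the monomial. *)
Definition setrow T (w : word T.+1) (t : 'I_T.+1) (b : 'I_d) : word T.+1 :=
  ins t (b, (w t).2) (del t w).

Lemma mix1E T A (w : word T.+1) t U :
  mix A [set t] w U = \sum_b A (w t).1 b * mono (setrow w t b) U.
Proof.
rewrite /mix (bigD1_ord t) //= inE eqxx mxE mulr_suml; apply: eq_bigr => b _.
rewrite mono_ins mulrA; congr (_ * _); apply: eq_bigr => t' _.
by rewrite inE eq_sym (negPf (neq_lift _ _)) ffunE.
Qed.

Lemma nice_mom T (w w' : word T) : nice (fun U => (mono w U)^* * mono w' U).
Proof.
by apply: (hm_mul hE); [apply: (hm_conj hE); exact: nice_mono|exact: nice_mono].
Qed.

(** The derivation identity is linear in [P] and known for projections, which span. This is its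
    coefficient at the matrix unit [E_ab]. *)
Lemma mom_derivation T (w w' : word T.+1) a b :
  \sum_t ((w' t).1 == a)%:R * mom w (setrow w' t b) =
  \sum_t ((w t).1 == b)%:R * mom (setrow w t a) w'.
Proof.
(* Indexed so that [\tr (P *m G)] is the difference of the two sides of the derivation identity for
   [P]. *)
pose G : 'M[C]_d := \matrix_(b, a) (
  \sum_t ((w' t).1 == a)%:R * mom w (setrow w' t b) -
  \sum_t ((w t).1 == b)%:R * mom (setrow w t a) w').
suff /matrixP/(_ b a) : G = 0 by rewrite !mxE => /eqP; rewrite subr_eq0 => /eqP.
apply: proj_span => P hP PP.
have := mean_derivation_proj w w' hP PP.
have -> : \sum_t E (fun U => (mono w U)^* * mix P [set t] w' U) =
    \sum_i \sum_j P i j * \sum_t ((w' t).1 == i)%:R * mom w (setrow w' t j).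
  under [RHS]eq_bigr => i _ do
    (under eq_bigr => j _ do rewrite mulr_sumr; rewrite exchange_big /=).
  rewrite [RHS]exchange_big /=; apply: eq_bigr => t _.
  rewrite [RHS](bigD1 (w' t).1) //= [X in _ = _ + X]big1 ?addr0 => [|i ni]; last first.
    by rewrite big1 // => j _; rewrite eq_sym (negPf ni) mul0r mulr0.
  under [RHS]eq_bigr do rewrite eqxx mul1r.
  rewrite -mean_sum => [|j]; last exact: nice_mom.
  apply: (hm_ext hE) => U _; rewrite mix1E mulr_sumr.
  by apply: eq_bigr => j _; rewrite mulrCA.
have -> : \sum_t E (fun U => (mix P [set t] w U)^* * mono w' U) =
    \sum_i \sum_j P i j * \sum_t ((w t).1 == j)%:R * mom (setrow w t i) w'.
  under [RHS]eq_bigr => i _ do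
    (under eq_bigr => j _ do rewrite mulr_sumr; rewrite exchange_big /=).
  rewrite [RHS]exchange_big /=; apply: eq_bigr => t _.
  rewrite [RHS]exchange_big /=.
  rewrite [RHS](bigD1 (w t).1) //= [X in _ = _ + X]big1 ?addr0 => [|i ni]; last first.
    by rewrite big1 // => j _; rewrite eq_sym (negPf ni) mul0r mulr0.
  under [RHS]eq_bigr do rewrite eqxx mul1r.
  rewrite -mean_sum => [|j]; last exact: nice_mom.
  apply: (hm_ext hE) => U _; rewrite mix1E rmorph_sum mulr_suml.
  apply: eq_bigr => j _; rewrite rmorphM /= -mulrA; congr (_ * _).
  by rewrite -{1}hP !mxE conjCK.
move/eqP; rewrite -subr_eq0 -sumrB => /eqP H; rewrite -[RHS]H.
apply: eq_bigr => i _; rewrite mxE -sumrB; apply: eq_bigr => j _.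
by rewrite !mxE mulrBr.
Qed.

(** * Row swaps and the Casimir identity *)

Definition rowswap T (s t : 'I_T.+1) (w : word T.+1) : word T.+1 :=
  setrow (setrow w s (w t).1) t (w s).1.

Lemma setrow_at T (w : word T.+1) t b : setrow w t b t = (b, (w t).2).
Proof. by rewrite ins_at. Qed.

Lemma setrow_ne T (w : word T.+1) t b r : r != t -> setrow w t b r = w r.
Proof.
case: (unliftP t r) => [r' ->|->]; rewrite ?eqxx // => _.
by rewrite ins_lift ffunE.
Qed.

Lemma setrowK T (w : word T.+1) t b : setrow (setrow w t b) t (w t).1 = w.
Proof.
apply/ffunP => r; have [->|nr] := eqVneq r t.
  by rewrite !setrow_at /=; case: (w t).
by rewrite !setrow_ne.
Qed.

Lemma rowswapE T (s t : 'I_T.+1) (w : word T.+1) r : s != t ->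
  rowswap s t w r = if r == s then ((w t).1, (w s).2)
                    else if r == t then ((w s).1, (w t).2) else w r.
Proof.
move=> nst; rewrite /rowswap; have [->|nrs] := eqVneq r s.
  by rewrite setrow_ne // setrow_at.
have [->|nrt] := eqVneq r t; last by rewrite !setrow_ne.
by rewrite setrow_at setrow_ne // eq_sym.
Qed.

Lemma rowswapK T (s t : 'I_T.+1) : s != t -> involutive (@rowswap T s t).
Proof.
move=> nst w; apply/ffunP => r; rewrite !(rowswapE _ _ nst) !eqxx.
rewrite [t == s]eq_sym (negPf nst).
have [->|_] := eqVneq r s; first by case: (w s).
by have [->|_] := eqVneq r t; first by case: (w t).
Qed.

(** Summing over the common row index contracts the two marked letters by [U ^t* *m U = 1]. *)
Lemma sum_mom_setrow T (w w' : word T.+1) s t :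
  \sum_b mom (setrow w s b) (setrow w' t b) =
  ((w s).2 == (w' t).2)%:R * mom (del s w) (del t w').
Proof.
transitivity (E (fun U => \sum_b
    1 * ((mono (setrow w s b) U)^* * mono (setrow w' t b) U))).
  rewrite mean_sum => [|b]; last exact: nice_mom.
  by apply: eq_bigr => b _; rewrite mul1r.
rewrite -[RHS]addr0 -[in RHS]mean0 -(hm_lin hE); first last.
- exact: (hm_cst hE).
- exact: nice_mom.
apply: (hm_ext hE) => U uU; rewrite addr0.
have /matrixP/(_ (w s).2 (w' t).2) := mulmx1C (unitarymxP uU).
rewrite !mxE => <-; rewrite mulr_suml; apply: eq_bigr => b _.
by rewrite !mono_ins rmorphM !mxE /=; ring.
Qed.

(* Both sides are the form [sum_(a,b) <E_ab U_w, E_ab U_w'>], where [E_ab] runs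
   over the matrix units acting as derivations on the monomials [U_w]: moving
   [E_ab] across by invariance produces the Casimir operator, and contracting
   the row indices by unitarity produces the gradient form on the right. *)
Lemma casimir T (w w' : word T.+1) :
  \sum_s \sum_t (if s == t then d%:R * mom w w' else mom (rowswap s t w) w') =
  \sum_s \sum_t (w s == w' t)%:R * mom (del s w) (del t w').
Proof.
apply: eq_bigr => s _.
(* For [t = s] every [b] restores [w], giving [d] copies of the moment; for other [t] only
   [b = (w t).1] survives and yields the swap. *)
transitivity (\sum_b \sum_t ((setrow w s b t).1 == b)%:R *
    mom (setrow (setrow w s b) t (w s).1) w').
  rewrite exchange_big /=; apply: eq_bigr => t _.
  have [<-|nst] := eqVneq s t.
    under eq_bigr do rewrite setrowK setrow_at eqxx mul1r.
    by rewrite sumr_const card_ord mulr_natl.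
  have nts : t != s by rewrite eq_sym.
  under eq_bigr do rewrite (setrow_ne _ _ nts).
  rewrite (bigD1 (w t).1) //= eqxx mul1r big1 ?addr0 // => b nb.
  by rewrite eq_sym (negPf nb) mul0r.
under eq_bigr do rewrite -mom_derivation.
rewrite exchange_big /=; apply: eq_bigr => t _.
rewrite -mulr_sumr sum_mom_setrow mulrA -natrM mulnb.
by case: (w s) (w' t) => [i j] [i' j']; rewrite /= xpair_eqE [i' == i]eq_sym.
Qed.

(** * The moment form and its comparison with the Fock form *)

Definition momform T (v : word T -> C) : C :=
  \sum_w \sum_w' (v w)^* * mom w w' * v w'.

Lemma momformE T (v : word T -> C) :
  momform v = E (fun U => (\sum_w v w * mono w U)^* * (\sum_w v w * mono w U)).
Proof.
transitivity (E (fun U => \sum_(p : word T * word T)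
    ((v p.1)^* * v p.2) * ((mono p.1 U)^* * mono p.2 U))).
  rewrite mean_sum => [|p]; last exact: nice_mom.
  rewrite /momform pair_big /=; apply: eq_bigr => p _.
  by rewrite mulrAC.
apply: (hm_ext hE) => U _; rewrite -(pair_big predT predT (fun w w' =>
  (v w)^* * v w' * ((mono w U)^* * mono w' U))) /=.
rewrite rmorph_sum mulr_suml; apply: eq_bigr => w _.
rewrite mulr_sumr; apply: eq_bigr => w' _; rewrite rmorphM /=; ring.
Qed.

Lemma mom_possemi T : possemi_kernel (@mom T).
Proof.
move=> v; rewrite -/(momform v) momformE; apply: (hm_ge0 hE).
  by apply: (hm_mul hE); [apply: (hm_conj hE)|]; apply: nice_sum => w;
    apply: (hm_mul hE); [exact: (hm_cst hE)|exact: nice_mono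
                        |exact: (hm_cst hE)|exact: nice_mono].
by move=> U _; rewrite mulrC mul_conjC_ge0.
Qed.

(** Splitting each word into a marked letter and the rest, the indicator identifies the two marked
    letters with a common [x]; the sums over positions then assemble the derivatives. *)
Lemma sum_ann_mom T (v : word T.+1 -> C) :
  \sum_(w : word T.+1) \sum_(w' : word T.+1) (v w)^* * (\sum_s \sum_t (w s == w' t)%:R *
     mom (del s w) (del t w')) * v w' =
  \sum_x momform (ann x v).
Proof.
transitivity (\sum_s \sum_t \sum_x \sum_u \sum_u'
   (v (ins s x u))^* * mom u u' * v (ins t x u')).
  transitivity (\sum_s \sum_t \sum_(w : word T.+1) \sum_(w' : word T.+1)
     (v w)^* * ((w s == w' t)%:R *
     mom (del s w) (del t w')) * v w').
    under eq_bigr => w _.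
      under eq_bigr => w' _ do rewrite mulr_sumr mulr_suml.
      rewrite exchange_big /=; over.
    rewrite exchange_big /=; apply: eq_bigr => s _.
    rewrite [RHS]exchange_big /=; apply: eq_bigr => w _.
    rewrite [RHS]exchange_big /=; apply: eq_bigr => w' _.
    by rewrite mulr_sumr mulr_suml.
  apply: eq_bigr => s _; apply: eq_bigr => t _.
  rewrite (big_word _ s); apply: eq_bigr => x _; apply: eq_bigr => u _.
  rewrite (big_word _ t) (bigD1 x) //= [X in _ + X]big1 ?addr0 => [|y ny]; last first.
    by apply: big1 => u' _; rewrite !ins_at eq_sym (negPf ny) !(mul0r, mulr0).
  by apply: eq_bigr => u' _; rewrite !ins_at !insK eqxx mul1r.
under eq_bigr do rewrite exchange_big /=.
rewrite exchange_big /=; apply: eq_bigr => x _; rewrite /momform /ann.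
under eq_bigr do rewrite exchange_big /=.
rewrite exchange_big /=; apply: eq_bigr => u _.
under eq_bigr do rewrite exchange_big /=.
rewrite exchange_big /=; apply: eq_bigr => u' _.
rewrite rmorph_sum !mulr_suml; apply: eq_bigr => s _.
by rewrite mulr_sumr.
Qed.

(** The swap is an involution on words, hence preserves the norm, and [|v - swap v|^2] is twice the
    difference of the two sides. *)
Lemma rowswap_contract T (s t : 'I_T.+1) (v : word T.+1 -> C) : s != t ->
  \sum_w (v w)^* * v (rowswap s t w) <= \sum_w (v w)^* * v w.
Proof.
move=> nst; set a := \sum_w _ * v (rowswap _ _ _); set b := \sum_w _.
have ea : a = \sum_w (v (rowswap s t w))^* * v w.
  rewrite /a (reindex_inj (inv_inj (rowswapK nst))) /=.
  by apply: eq_bigr => w _; rewrite rowswapK.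
have eb : b = \sum_w (v (rowswap s t w))^* * v (rowswap s t w).
  by rewrite /b (reindex_inj (inv_inj (rowswapK nst))).
have : 0 <= \sum_w (v w - v (rowswap s t w))^* * (v w - v (rowswap s t w)).
  by apply: sumr_ge0 => w _; rewrite mulrC mul_conjC_ge0.
have -> : \sum_w (v w - v (rowswap s t w))^* * (v w - v (rowswap s t w)) =
    2 * (b - a).
  transitivity (b - a - a + b); last by ring.
  rewrite {1}/b {1}/a ea eb -!sumrB -big_split /=.
  by apply: eq_bigr => w _; rewrite rmorphB /=; ring.
by rewrite pmulr_rge0 ?ltr0n // subr_ge0.
Qed.

Lemma momform_step T (v : word T.+1 -> C) :
  \sum_x momform (ann x v) <= T.+1%:R * (d + T)%:R * momform v.
Proof.
pose Cas (w z : word T.+1) : C := \sum_s \sum_t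
  (if s == t then d%:R * (z == w)%:R else (z == rowswap s t w)%:R).
(* An upper bound for the Casimir operator: [d] for each of the [T.+1] diagonal pairs and 1 for each
   of the [T.+1 * T] swaps. *)
pose c : C := T.+1%:R * (d + T)%:R.
pose K (w z : word T.+1) : C := c * (w == z)%:R - Cas w z.
have pick (F : word T.+1 -> C) w : \sum_z (z == w)%:R * F z = F w.
  rewrite (bigD1 w) //= eqxx mul1r big1 ?addr0 // => z /negPf ->.
  by rewrite mul0r.
have CasM F w : \sum_z Cas w z * F z = \sum_s \sum_t
    (if s == t then d%:R * F w else F (rowswap s t w)).
  under eq_bigr do rewrite mulr_suml.
  rewrite exchange_big /=; apply: eq_bigr => s _.
  under eq_bigr do rewrite mulr_suml.
  rewrite exchange_big /=; apply: eq_bigr => t _.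
  case: eqP => _; last exact: pick.
  under eq_bigr do rewrite -mulrA.
  by rewrite -mulr_sumr pick.
have CasS w z : Cas w z = Cas z w.
  apply: eq_bigr => s _; apply: eq_bigr => t _.
  have [_|nst] := eqVneq s t; first by rewrite eq_sym.
  by rewrite eq_sym (can2_eq (rowswapK nst) (rowswapK nst)).
have CasR w z : (Cas w z)^* = Cas w z.
  rewrite /Cas rmorph_sum; apply: eq_bigr => s _.
  rewrite rmorph_sum; apply: eq_bigr => t _.
  by case: eqP => _; rewrite ?rmorphM /= !rmorph_nat.
pose S (w z : word T.+1) : C := \sum_s \sum_t (w s == z t)%:R * mom (del s w) (del t z).
have CM w z : \sum_y Cas w y * mom y z = S w z by rewrite CasM casimir.
have hm n := possemi_kernel_herm (@mom_possemi n).
have SC w z : (S w z)^* = S z w.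
  rewrite /S rmorph_sum exchange_big /=; apply: eq_bigr => s _.
  rewrite rmorph_sum; apply: eq_bigr => t _.
  by rewrite rmorphM rmorph_nat /= hm eq_sym.
(* [Cas] is real symmetric while [mom] and [S] are Hermitian, so taking adjoints in [CM] shows that
   [Cas] and [mom] commute. *)
have MC w z : \sum_y mom w y * Cas y z = S w z.
  rewrite -SC -CM rmorph_sum; apply: eq_bigr => y _.
  by rewrite rmorphM /= hm CasR CasS mulrC.
have KM w z : \sum_y K w y * mom y z = c * mom w z - S w z.
  under eq_bigr do rewrite mulrBl -mulrA [w == _]eq_sym.
  by rewrite sumrB -mulr_sumr pick CM.
have MK w z : \sum_y mom w y * K y z = c * mom w z - S w z.
  under eq_bigr do rewrite mulrBr mulrCA [mom _ _ * (_ == _)%:R]mulrC.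
  by rewrite sumrB -mulr_sumr pick MC.
have pK : possemi_kernel K.
  move=> u; pose N := \sum_w (u w)^* * u w.
  have -> : \sum_w \sum_z (u w)^* * K w z * u z =
      c * N - \sum_s \sum_t (if s == t then d%:R * N
                            else \sum_w (u w)^* * u (rowswap s t w)).
    transitivity (\sum_w (u w)^* * (c * u w - \sum_z Cas w z * u z)).
      apply: eq_bigr => w _; under eq_bigr do rewrite -mulrA.
      rewrite -mulr_sumr; congr (_ * _).
      under eq_bigr do rewrite mulrBl -mulrA [w == _]eq_sym.
      by rewrite sumrB -mulr_sumr pick.
    under eq_bigr do rewrite mulrBr mulrCA.
    rewrite sumrB -mulr_sumr -/N; congr (_ - _).
    under eq_bigr do rewrite CasM mulr_sumr.
    rewrite exchange_big /=; apply: eq_bigr => s _.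
    under eq_bigr do rewrite mulr_sumr.
    rewrite exchange_big /=; apply: eq_bigr => t _.
    case: eqP => _ //; under eq_bigr do rewrite mulrCA.
    by rewrite -mulr_sumr.
  rewrite subr_ge0.
  apply: (@le_trans _ _ (\sum_(s < T.+1) (d + T)%:R * N)); last first.
    by rewrite sumr_const card_ord -[leLHS]mulr_natl mulrA.
  apply: ler_sum => s _; rewrite (bigD1 s) //= eqxx natrD mulrDl lerD2l.
  apply: (@le_trans _ _ (\sum_(t < T.+1 | t != s) N)).
    apply: ler_sum => t nt; rewrite eq_sym (negPf nt).
    by apply: rowswap_contract; rewrite eq_sym.
  by rewrite sumr_const cardC1 card_ord mulr_natl.
(* Positivity of the commuting product [(c - Cas) mom], evaluated at [v], is the claimed
   inequality. *)
have H := possemi_kernel_comm pK (@mom_possemi T.+1)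
  (fun w z => etrans (KM w z) (esym (MK w z))) v.
rewrite -sum_ann_mom -/c -subr_ge0; apply: le_trans H _.
rewrite le_eqVlt; apply/orP; left; apply/eqP.
rewrite /momform mulr_sumr -sumrB; apply: eq_bigr => w _.
rewrite mulr_sumr -sumrB; apply: eq_bigr => z _.
by rewrite KM /S; ring.
Qed.

(** Both forms pass to derivatives: [fock] by definition, [momform] at the cost [T.+1 * (d + T)] per
    step. In degree 0 they agree because the mean of 1 is 1. *)
Lemma fock_le_momform T (v : word T -> C) :
  fock v v <= T`!%:R * (\prod_(t < T) (d + t)%:R) * momform v.
Proof.
elim: T v => [|T IH] v.
  rewrite fact0 big_ord0 !mul1r /momform /= ler_sum // => w _.
  rewrite (bigD1 w) //= big1 => [|w' nw]; last first.
    by rewrite (word0_eq w' w) eqxx in nw.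
  rewrite addr0 (_ : mom w w = 1) ?mulr1 // -(hm_one hE).
  by apply: (hm_ext hE) => U _; rewrite /mono !big_ord0 conjC1 mul1r.
rewrite fockS; apply: le_trans (ler_sum _ (fun x _ => IH (ann x v))) _.
rewrite -mulr_sumr big_ord_recr /= factS natrM.
set p := \prod_(_ < T) _.
have p0 : 0 <= T`!%:R * p by rewrite mulr_ge0 // prodr_ge0.
apply: le_trans (ler_wpM2l p0 (momform_step v)) _.
by rewrite le_eqVlt; apply/orP; left; apply/eqP; ring.
Qed.

Lemma mean_prod_ge T (A : 'I_T -> 'M[C]_d) : (0 < d)%N ->
  \prod_t ((\sum_i \sum_j A t i j * (A t i j)^*) / (d + t)%:R) <=
  E (fun U => \prod_t ((\tr (U *m A t))^* * \tr (U *m A t))).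
Proof.
(* The indices are exchanged because [\tr (U *m A)] pairs [U i j] with [A j i]. The factor [T!]
   cancels between the two bounds combined next. *)
move=> d0; pose L t (x : X) := A t x.2 x.1.
have := le_trans (fock_prod_ge L) (fock_le_momform _).
rewrite -mulrA ler_pM2l ?ltr0n ?fact_gt0 //.
rewrite momformE prodf_div ler_pdivrMr; last first.
  by apply: prodr_gt0 => t _; rewrite ltr0n addn_gt0 d0.
rewrite [X in _ <= X -> _]mulrC; congr (_ <= _ * _).
  by apply: eq_bigr => t _; rewrite exchange_big pair_big.
apply: (hm_ext hE) => U _; rewrite big_split /= -rmorph_prod.
suff -> : \sum_(w : word T) (\prod_t L t (w t)) * mono w U = \prod_t \tr (U *m A t) by [].
rewrite (eq_bigr (fun w : word T => \prod_t (L t (w t) * U (w t).1 (w t).2))); last first.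
  by move=> w _; rewrite big_split.
rewrite -(bigA_distr_bigA (fun t x => L t x * U x.1 x.2)).
apply: eq_bigr => t _; rewrite /mxtrace.
under [RHS]eq_bigr do rewrite mxE.
by rewrite pair_big; apply: eq_bigr => -[i j] _; rewrite mulrC.
Qed.

End Moments.

(** * Integration against the Haar measure *)

Local Open Scope classical_set_scope.

Section ComplexRI.
Variable R : realType.
Local Notation C := (R[i]).

Lemma cReD (x y : C) : complex.Re (x + y) = complex.Re x + complex.Re y.
Proof. by case: x y => [a b] [c e]. Qed.
Lemma cImD (x y : C) : complex.Im (x + y) = complex.Im x + complex.Im y.
Proof. by case: x y => [a b] [c e]. Qed.
Lemma cReM (x y : C) : complex.Re (x * y) =
  complex.Re x * complex.Re y - complex.Im x * complex.Im y.
Proof. by case: x y => [a b] [c e]. Qed.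
Lemma cImM (x y : C) : complex.Im (x * y) =
  complex.Re x * complex.Im y + complex.Im x * complex.Re y.
Proof. by case: x y => [a b] [c e]. Qed.
Lemma cReJ (x : C) : complex.Re (x^*)%R = complex.Re x.
Proof. by case: x => [a b]. Qed.
Lemma cImJ (x : C) : complex.Im (x^*)%R = - complex.Im x.
Proof. by case: x => [a b]. Qed.
Lemma cReB (x y : C) : complex.Re (x - y) = complex.Re x - complex.Re y.
Proof. by case: x y => [a b] [c e]. Qed.
Lemma cImB (x y : C) : complex.Im (x - y) = complex.Im x - complex.Im y.
Proof. by case: x y => [a b] [c e]. Qed.

Lemma normc_ge_Im (x : C) : (`|complex.Im x|)%:C%C <= `|x|.
Proof.
rewrite normc_def lecR -sqrtr_sqr ler_wsqrtr // lerDr sqr_ge0 //.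
Qed.

Lemma Re_continuous : continuous (fun z : C^o => complex.Re z : R).
Proof.
move=> z A /= /nbhs_ballP [e e0 eA].
apply/nbhs_ballP; exists (e%:C%C) => /=; first by rewrite ltcR.
move=> y /= zy; apply: eA; rewrite /ball /= -ltcR -cReB.
by apply: le_lt_trans zy; exact: normc_ge_Re.
Qed.
Lemma Im_continuous : continuous (fun z : C^o => complex.Im z : R).
Proof.
move=> z A /= /nbhs_ballP [e e0 eA].
apply/nbhs_ballP; exists (e%:C%C) => /=; first by rewrite ltcR.
move=> y /= zy; apply: eA; rewrite /ball /= -ltcR -cImB.
by apply: le_lt_trans zy; exact: normc_ge_Im.
Qed.

End ComplexRI.

Section HaarMean.
Variables (R : realType) (d : nat).
Local Notation C := (R[i]).

Lemma measurable_open (A : set 'M[C^o]_(d, d)) : open A -> measurable (A : set (MB R d)).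
Proof. by move=> oA; exact: sub_sigma_algebra. Qed.

Lemma measurable_continuous (f : 'M[C^o]_(d, d) -> R) :
  continuous f -> measurable_fun setT (f : MB R d -> R).
Proof.
move=> /continuousP cf; apply: (measurability _ (RGenOpens.measurableE R)).
move=> _ [_ [a [b ->] <-]]; rewrite setTI; apply: measurable_open.
exact/cf/interval_open.
Qed.

Lemma measurable_Re_coord i j :
  measurable_fun setT (fun M : MB R d => complex.Re (toC M i j)).
Proof.
apply: (measurable_continuous (f := fun M => complex.Re (M i j))) => M.
apply: (@continuous_comp _ _ _ (fun M : 'M[C^o]_(d, d) => M i j : C^o)).
  exact: coord_continuous.
exact: Re_continuous.
Qed.

Lemma measurable_Im_coord i j :
  measurable_fun setT (fun M : MB R d => complex.Im (toC M i j)).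
Proof.
apply: (measurable_continuous (f := fun M => complex.Im (M i j))) => M.
apply: (@continuous_comp _ _ _ (fun M : 'M[C^o]_(d, d) => M i j : C^o)).
  exact: coord_continuous.
exact: Im_continuous.
Qed.

Lemma mulmx_continuous (V : 'M[C]_d) :
  continuous (fun M : 'M[C^o]_(d, d) => (V *m M : 'M[C^o]_(d, d))).
Proof.
move=> M A /= [P MP PA].
(* In the product topology a neighbourhood contains a box of entrywise conditions [P]; being
   finitely many, they can be imposed one entry at a time. *)
suff : nbhs M [set N : 'M[C^o]_(d, d) |
    forall ij : 'I_d * 'I_d, P ij.1 ij.2 ((V *m (N : 'M[C]_d)) ij.1 ij.2)].
  by apply: filterS => N HN; apply: PA => i j; exact: (HN (i, j)).
apply: (@filter_forall _ _ (fun ij (N : 'M[C^o]_(d, d)) =>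
  P ij.1 ij.2 ((V *m (N : 'M[C]_d)) ij.1 ij.2)) (nbhs M)) => -[i j] /=.
have : (fun N : 'M[C^o]_(d, d) => (V *m N) i j : C^o) @ M --> ((V *m M) i j : C^o).
  under eq_fun do rewrite mxE.
  rewrite mxE; have FM : Filter (nbhs M) by exact: nbhs_filter.
  apply: (@cvg_big C^o _ _ _ predT (@add_continuous C^o) _ (nbhs M) _
    (fun k (N : 'M[C^o]_(d, d)) => V i k * N k j : C^o) _ FM) => k _.
  by apply: cvgMl_tmp; exact: coord_continuous.
by apply; exact: MP.
Qed.

Lemma measurable_mulmx (V : 'M[C]_d) :
  measurable_fun setT (fun M : MB R d => ofC (V *m toC M)).
Proof.
apply: (@measurability _ _ (MB R d) (MB R d) _ _ (@open 'M[C^o]_(d, d))) => //.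
move=> _ [A oA <-]; rewrite setTI; apply: measurable_open.
by have /continuousP := @mulmx_continuous V; apply.
Qed.

(** * Bounded measurable complex functions and their Haar expectation *)

Definition cmeasurable (F : 'M[C]_d -> C) :=
  measurable_fun setT (fun M : MB R d => complex.Re (F (toC M))) /\
  measurable_fun setT (fun M : MB R d => complex.Im (F (toC M))).

Lemma cmeasurable_cst c : cmeasurable (fun=> c).
Proof. by split; exact: measurable_cst. Qed.

Lemma cmeasurable_coord i j : cmeasurable (fun U => U i j).
Proof. by split; [exact: measurable_Re_coord|exact: measurable_Im_coord]. Qed.

Lemma cmeasurable_add F G : cmeasurable F -> cmeasurable G ->
  cmeasurable (fun U => F U + G U).
Proof.
move=> [F1 F2] [G1 G2]; split.
  by under eq_fun do rewrite cReD; exact: measurable_funD.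
by under eq_fun do rewrite cImD; exact: measurable_funD.
Qed.

Lemma cmeasurable_mul F G : cmeasurable F -> cmeasurable G ->
  cmeasurable (fun U => F U * G U).
Proof.
move=> [F1 F2] [G1 G2]; split.
  by under eq_fun do rewrite cReM; apply: measurable_funB; exact: measurable_funM.
by under eq_fun do rewrite cImM; apply: measurable_funD; exact: measurable_funM.
Qed.

Lemma cmeasurable_conj F : cmeasurable F -> cmeasurable (fun U => (F U)^*).
Proof.
move=> [F1 F2]; split; first by under eq_fun do rewrite cReJ.
under eq_fun do rewrite cImJ.
exact: measurableT_comp.
Qed.

Lemma cmeasurable_sum (I : Type) (r : seq I) (F : I -> 'M[C]_d -> C) :
  (forall i, cmeasurable (F i)) -> cmeasurable (fun U => \sum_(i <- r) F i U).
Proof.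
move=> nF; elim: r => [|i r IH].
  by under eq_fun do rewrite big_nil; exact: cmeasurable_cst.
by under eq_fun do rewrite big_cons; exact: cmeasurable_add.
Qed.

(** [U(d)] is the zero set of the polynomial [F], the sum of the squared moduli of the entries of
    [U U^* - 1]. *)
Lemma measurable_unitary_set : measurable (@unitary_set R d).
Proof.
pose z (U : 'M[C]_d) i j := (U *m U ^t*) i j + (- (i == j)%:R).
pose F U := \sum_i \sum_j z U i j * (z U i j)^*.
have mz i j : cmeasurable (fun U => z U i j).
  apply: cmeasurable_add; last exact: cmeasurable_cst.
  under eq_fun do rewrite mxE; apply: cmeasurable_sum => k.
  apply: cmeasurable_mul; first exact: cmeasurable_coord.
  by under eq_fun do rewrite !mxE; apply: cmeasurable_conj; exact: cmeasurable_coord.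
have [mF _] : cmeasurable F.
  apply: cmeasurable_sum => i; apply: cmeasurable_sum => j.
  by apply: cmeasurable_mul => //; exact: cmeasurable_conj.
have -> : @unitary_set R d = (fun M : MB R d => complex.Re (F (toC M))) @^-1` [set 0].
  apply/seteqP; split => M /=.
    move=> /unitarymxP uM; rewrite /F big1 // => i _; rewrite big1 // => j _.
    by rewrite /z uM mxE subrr mul0r.
  move=> F0; apply/unitarymxP/matrixP => i j; apply/eqP.
  have zz k l : 0 <= z (toC M) k l * (z (toC M) k l)^* by exact: mul_conjC_ge0.
  have Fz : F (toC M) = 0.
    have F_ge0 : 0 <= F (toC M) by apply: sumr_ge0 => k _; apply: sumr_ge0.
    by apply/eqP; rewrite eq_le F_ge0 andbT lecE F0 lexx andbT /= eq_sym;
      rewrite (ger0_Im F_ge0).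
  have /psumr_eq0P/(_ i isT) : F (toC M) = 0 by [].
  move=> H; have {}H := H (fun k _ => sumr_ge0 _ (fun l _ => zz k l)).
  have := @psumr_eq0P _ _ predT _ (fun l _ => zz i l) H j isT.
  by move/eqP; rewrite mul_conjC_eq0 /z subr_eq0 => /eqP ->; rewrite mxE.
rewrite -[X in measurable X]setTI; apply: mF => //.
Qed.

Definition cbounded (F : 'M[C]_d -> C) :=
  exists b : R, forall U, U \is unitarymx -> `|F U| <= b%:C%C.

(** Boundedness rather than integrability, because the class has to be closed under products; under
    a probability measure it implies integrability over [U(d)]. *)
Definition bmeasurable F := cmeasurable F /\ cbounded F.

Lemma normcRe (x : C) : `|x| = (complex.Re `|x|)%:C%C.
Proof. by rewrite normc_def. Qed.

Lemma unitary_coord_le1 (U : 'M[C]_d) i j : U \is unitarymx -> `|U i j| <= 1.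
Proof.
move=> /unitarymxP/matrixP/(_ i i); rewrite !mxE eqxx => H.
rewrite -(@ler_pXn2r _ 2) ?nnegrE // expr1n -[leRHS]/(true%:R) -H.
rewrite (bigD1 j) //= !mxE -normCK lerDl.
by apply: sumr_ge0 => k _; rewrite !mxE -normCK exprn_ge0.
Qed.

Variable mu : probability (MB R d) R.

Definition haarE (F : 'M[C]_d -> C) : C :=
  complex.Complex (\int[mu]_(M in @unitary_set R d) complex.Re (F (toC M)))%R
  (\int[mu]_(M in @unitary_set R d) complex.Im (F (toC M)))%R.

Lemma bounded_integrable (g : MB R d -> R) (b : R) : measurable_fun setT g ->
  (forall M, @unitary_set R d M -> `|g M| <= b) ->
  mu.-integrable (@unitary_set R d) (EFin \o g).
Proof.
move=> mg gb; apply: measurable_bounded_integrable.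
- exact: measurable_unitary_set.
- apply: (@le_lt_trans _ _ 1%E); last exact: ltry.
  by apply: probability_le1; exact: measurable_unitary_set.
- exact: measurable_funTS.
- exists b; split; first exact: num_real.
  by move=> x bx M DM; exact: le_trans (gb M DM) (ltW bx).
Qed.

Lemma integrable_Re F : bmeasurable F ->
  mu.-integrable (@unitary_set R d) (EFin \o (fun M => complex.Re (F (toC M)))).
Proof.
move=> [[mF _] [b Fb]]; apply: (bounded_integrable (b := b)) => // M uM.
by rewrite -lecR; apply: le_trans (Fb _ uM); exact: normc_ge_Re.
Qed.

Lemma integrable_Im F : bmeasurable F ->
  mu.-integrable (@unitary_set R d) (EFin \o (fun M => complex.Im (F (toC M)))).
Proof.
move=> [[_ mF] [b Fb]]; apply: (bounded_integrable (b := b)) => // M uM.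
by rewrite -lecR; apply: le_trans (Fb _ uM); exact: normc_ge_Im.
Qed.

Hypothesis hmu : haar_prob mu.

(** Change of variables along [phi], multiplication by [V]: the pushforward of [mu] agrees with [mu]
    on measurable sets, and [U(d)] is its own preimage. *)
Lemma haar_inv_real (g : MB R d -> R) (b : R) V : V \is unitarymx ->
  measurable_fun setT g ->
  (forall M, @unitary_set R d M -> `|g M| <= b) ->
  (\int[mu]_(M in @unitary_set R d) g (ofC (V *m toC M)))%R =
  (\int[mu]_(M in @unitary_set R d) g M)%R.
Proof.
move=> uV mg gb; pose phi (M : MB R d) : MB R d := ofC (V *m toC M).
have mphi : measurable_fun setT phi by exact: measurable_mulmx.
have phiD : phi @^-1` @unitary_set R d = @unitary_set R d.
  apply/seteqP; split => M; rewrite /phi /unitary_set /ofC /toC /= => uM; last first.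
    exact: mul_unitarymx.
  have -> : M = V ^t* *m (V *m M).
    by rewrite mulmxA (mulmx1C (unitarymxP uV)) mul1mx.
  by apply: mul_unitarymx; rewrite ?trmxC_unitary.
rewrite /Rintegral; congr fine.
rewrite -{1}phiD.
have ig : mu.-integrable (phi @^-1` @unitary_set R d) ((EFin \o g) \o phi).
  rewrite phiD; apply: (bounded_integrable (g := g \o phi) (b := b)).
    exact: measurableT_comp.
  by move=> M uM; apply: gb; move: uM; rewrite -{1}phiD.
have mg' : measurable_fun setT (EFin \o g) by exact/measurable_EFinP.
rewrite -(integral_pushforward mphi mg' ig measurable_unitary_set).
apply: eq_measure_integral => A mA _.
by rewrite /= /pushforward (proj2 hmu).
Qed.

Lemma haarE_mean : haar_mean bmeasurable haarE.
Proof.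
have mD := @measurable_unitary_set.
have eqI (F G : MB R d -> R) : (forall U, @unitary_set R d U -> F U = G U) ->
    (\int[mu]_(M in @unitary_set R d) F M)%R = (\int[mu]_(M in @unitary_set R d) G M)%R.
  by move=> FG; apply: eq_Rintegral => M; rewrite inE; exact: FG.
split.
- move=> c; split; first exact: cmeasurable_cst.
  by exists (complex.Re `|c|) => U _; rewrite -normcRe.
- move=> i j; split; first exact: cmeasurable_coord.
  by exists 1 => U uU; exact: unitary_coord_le1.
- move=> F G [mF [b Fb]] [mG [c Gc]]; split; first exact: cmeasurable_add.
  exists (b + c) => U uU; rewrite rmorphD /=.
  by apply: le_trans (ler_normD _ _) _; rewrite lerD ?Fb ?Gc.
- move=> F G [mF [b Fb]] [mG [c Gc]]; split; first exact: cmeasurable_mul.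
  exists (b * c) => U uU; rewrite rmorphM /= normrM.
  by rewrite ler_pM ?Fb ?Gc.
- move=> F [mF [b Fb]]; split; first exact: cmeasurable_conj.
  by exists b => U uU; rewrite norm_conjC Fb.
- rewrite /haarE !(Rintegral_cst mu mD); set x := fine _.
  have -> : x = 1 by exact: (congr1 fine (proj1 hmu)).
  by rewrite !mulr1.
- move=> c F G nF nG; rewrite /haarE.
  have [iF jF] := (integrable_Re nF, integrable_Im nF).
  have [iG jG] := (integrable_Re nG, integrable_Im nG).
  have ZI (a : R) (g : MB R d -> R) : mu.-integrable (@unitary_set R d) (EFin \o g) ->
     mu.-integrable (@unitary_set R d) (EFin \o (fun M => a * g M)).
    by move=> ig; apply: (integrableZl mD a ig).
  apply/eqP; rewrite eq_complex cReD cImD cReM cImM /=; apply/andP; split; apply/eqP.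
    transitivity (\int[mu]_(M in @unitary_set R d)
       (complex.Re c * complex.Re (F (toC M)) - complex.Im c * complex.Im (F (toC M))
        + complex.Re (G (toC M))))%R.
      by apply: eqI => U _; rewrite cReD cReM.
    rewrite RintegralD // ?RintegralB ?RintegralZl //; try exact: ZI.
    exact: (integrableB mD (ZI _ _ iF) (ZI _ _ jF)).
  transitivity (\int[mu]_(M in @unitary_set R d)
     (complex.Re c * complex.Im (F (toC M)) + complex.Im c * complex.Re (F (toC M))
      + complex.Im (G (toC M))))%R.
    by apply: eqI => U _; rewrite cImD cImM.
  rewrite RintegralD // ?RintegralD ?RintegralZl //; try exact: ZI.
  exact: (integrableD mD (ZI _ _ jF) (ZI _ _ iF)).
- move=> F G FG; rewrite /haarE; congr complex.Complex; apply: eqI => U uU; by rewrite FG.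
- move=> F nF F0; rewrite lecE /=; apply/andP; split; last first.
    by apply: Rintegral_ge0 => M uM; have := F0 _ uM; rewrite lecE => /andP[].
  rewrite (eqI _ (fun=> 0)); first by rewrite Rintegral_cst // mul0r.
  by move=> M uM; exact/ger0_Im/F0.
- move=> F V [[mF1 mF2] [b Fb]] uV; rewrite /haarE; congr complex.Complex.
    apply: (haar_inv_real (g := fun M => complex.Re (F (toC M))) (b := b)) => // M uM.
    by rewrite -lecR; apply: le_trans (Fb _ uM); exact: normc_ge_Re.
  apply: (haar_inv_real (g := fun M => complex.Im (F (toC M))) (b := b)) => // M uM.
  by rewrite -lecR; apply: le_trans (Fb _ uM); exact: normc_ge_Im.
Qed.

End HaarMean.

(** * Channels and learning algorithms *)

Section Channels.
Variables (R : realType) (d e : nat).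
Local Notation C := (R[i]).

Lemma tens_idE (Phi : 'M[C]_d -> 'M[C]_d) (rho : 'M[C]_(d * e)) i a j b :
  tens_id Phi rho (mxtens_index (i, a)) (mxtens_index (j, b)) =
  Phi (\matrix_(i, j) rho (mxtens_index (i, a)) (mxtens_index (j, b))) i j.
Proof.
rewrite /tens_id summxE (bigD1 a) //= summxE (bigD1 b) //= tensmxE mxE !eqxx mulr1.
rewrite big1 => [|b' /negPf nb]; last by rewrite tensmxE mxE eq_sym nb andbF mulr0.
rewrite addr0 big1 ?addr0 // => a' /negPf na; rewrite summxE big1 // => b' _.
by rewrite tensmxE mxE eq_sym na mulr0.
Qed.

Lemma sum_tens (V : nmodType) (F : 'I_(d * e) -> V) :
  \sum_x F x = \sum_i \sum_a F (mxtens_index (i, a)).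
Proof.
rewrite pair_big /= (reindex (@mxtens_index d e)) /=; last first.
  by exists (@mxtens_unindex d e) => x _; rewrite (mxtens_indexK, mxtens_unindexK).
by apply: eq_bigr => -[i a].
Qed.

Lemma tr_tens_id (Phi : 'M[C]_d -> 'M[C]_d) (rho : 'M[C]_(d * e)) :
  (forall X, \tr (Phi X) = \tr X) -> \tr (tens_id Phi rho) = \tr rho.
Proof.
move=> tP; rewrite /mxtrace !sum_tens exchange_big [RHS]exchange_big /=.
apply: eq_bigr => a _; under eq_bigr do rewrite tens_idE.
by rewrite -/(mxtrace _) tP; apply: eq_bigr => i _; rewrite mxE.
Qed.

Lemma tr_unitary_channel (U X : 'M[C]_d) : U \is unitarymx ->
  \tr (unitary_channel U X) = \tr X.
Proof.
by move=> uU; rewrite mxtrace_mulC mulmxA (mulmx1C (unitarymxP uU)) mul1mx.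
Qed.

Lemma tr_depolarizing (X : 'M[C]_d) : (0 < d)%N -> \tr (depolarizing X) = \tr X.
Proof.
move=> d0; rewrite mxtrace_scalar -[LHS]mulr_natr mulfVK //.
by rewrite pnatr_eq0 -lt0n.
Qed.

(* With [F = sum_k |f_k><f_k|] and [phi], [f_k] reshaped as [d x e] matrices,
   [<f_k| (U (x) 1) |phi> = tr (U A_k)] where [A_k = phi f_k^*]. *)
Lemma povm_element (F : 'M[C]_(d * e)) (phi : 'cV[C]_(d * e)) : psd F ->
  exists A : 'I_(d * e) -> 'M[C]_d,
    (forall U, \tr (F *m tens_id (unitary_channel U) (density phi)) =
       \sum_k (\tr (U *m A k))^* * \tr (U *m A k)) /\
    \tr (F *m tens_id (@depolarizing R d) (density phi)) =
       (\sum_k \sum_i \sum_j A k i j * (A k i j)^*) / d%:R.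
Proof.
move=> /possemi_spectral[P [D [uP D0 eF]]].
(* Row [k] of the eigenbasis scaled by the root of its eigenvalue, which splits [F] into rank-one
   terms. *)
pose f k x := sqrtC (D 0 k) * P k x.
have trF X : \tr (F *m X) = \sum_k \sum_x \sum_y (f k x)^* * f k y * X y x.
  rewrite /mxtrace [RHS]exchange_big /=; apply: eq_bigr => x _.
  rewrite mxE [RHS]exchange_big /=; apply: eq_bigr => y _.
  rewrite -mulr_suml; congr (_ * _); rewrite eF mul_mx_diag mxE.
  apply: eq_bigr => k _; rewrite !mxE /f rmorphM /=.
  rewrite (geC0_conj (_ : 0 <= sqrtC _)) ?sqrtC_ge0 //.
  by rewrite -[in LHS](sqrtCK (D 0 k)); ring.
clearbody f.
pose ph i a := phi (mxtens_index (i, a)) 0.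
pose A k : 'M[C]_d := \matrix_(i', i) \sum_a ph i' a * f k (mxtens_index (i, a)).
have trX X : \tr (F *m X) = \sum_k \sum_i \sum_a \sum_j \sum_b
   (f k (mxtens_index (i, a)))^* * f k (mxtens_index (j, b)) *
   X (mxtens_index (j, b)) (mxtens_index (i, a)).
  rewrite trF; apply: eq_bigr => k _; rewrite sum_tens.
  by apply: eq_bigr => i _; apply: eq_bigr => a _; rewrite sum_tens.
exists A; split=> [U|].
  rewrite trX; apply: eq_bigr => k _.
  have -> : \tr (U *m A k) = \sum_j \sum_b f k (mxtens_index (j, b)) *
      \sum_l U j l * ph l b.
    apply: eq_bigr => j _; rewrite mxE.
    under [RHS]eq_bigr do rewrite mulr_sumr.
    rewrite [RHS]exchange_big /=; apply: eq_bigr => l _; rewrite mxE mulr_sumr.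
    by apply: eq_bigr => b _; ring.
  rewrite rmorph_sum mulr_suml; apply: eq_bigr => i _.
  rewrite rmorph_sum mulr_suml; apply: eq_bigr => a _.
  rewrite mulr_sumr; apply: eq_bigr => j _.
  rewrite mulr_sumr; apply: eq_bigr => b _.
  rewrite tens_idE rmorphM /= -!mulrA; congr (_ * _).
  rewrite mulrCA; congr (_ * _).
  rewrite /unitary_channel mxE rmorph_sum mulr_suml; apply: eq_bigr => l _.
  rewrite !mxE mulr_suml mulr_sumr; apply: eq_bigr => m _.
  by rewrite !mxE big_ord1 !mxE /ph rmorphM /=; ring.
rewrite trX mulr_suml; apply: eq_bigr => k _.
rewrite [X in _ = X / _]exchange_big /= mulr_suml; apply: eq_bigr => i _.
(* Each depolarized block is scalar, so only [j = i] survives, with the trace of the block summed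
   over [l]. *)
transitivity (\sum_a \sum_b \sum_l (ph l b * f k (mxtens_index (i, b)) *
    ((ph l a)^* * (f k (mxtens_index (i, a)))^*)) / d%:R).
  apply: eq_bigr => a _; rewrite (bigD1 i) //= [X in _ + X]big1 ?addr0; last first.
    move=> j /negPf nj; apply: big1 => b _.
    by rewrite tens_idE mxE nj mulr0n mulr0.
  apply: eq_bigr => b _; rewrite tens_idE mxE eqxx mulr1n /mxtrace.
  rewrite mulrA mulr_sumr mulr_suml.
  by apply: eq_bigr => l _; rewrite !mxE big_ord1 !mxE /ph /=; ring.
rewrite mulr_suml.
under eq_bigr do rewrite exchange_big /=.
rewrite exchange_big /=; apply: eq_bigr => l _; rewrite !mxE rmorph_sum.
rewrite -mulrA mulr_suml exchange_big /=; apply: eq_bigr => b _.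
rewrite mulr_suml mulr_sumr; apply: eq_bigr => a _.
by rewrite rmorphM /= -mulrA.
Qed.

End Channels.

Lemma sum_adaptive_prod (C : comPzRingType) (I : finType) T (p : seq I -> I -> C) :
  (forall h, \sum_s p h s = 1) ->
  \sum_(tr : T.-tuple I) \prod_(t < T) p (take t tr) (tnth tr t) = 1.
Proof.
move=> p1.
(* Generalized over the history [h], which absorbs the first outcome at each induction step. *)
suff H h : \sum_(tr : T.-tuple I) \prod_(t < T) p (h ++ take t tr) (tnth tr t) = 1.
  exact: (H [::]).
elim: T h => [|T IH] h.
  rewrite (big_pred1 [tuple]) ?big_ord0 // => tr.
  by apply/esym/eqP/val_inj; rewrite (tuple0 tr).
rewrite (reindex (fun q : I * T.-tuple I => [tuple of q.1 :: q.2])) /=; last first.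
  exists (fun tr : T.+1.-tuple I => (thead tr, [tuple of behead tr]))
    => [[x tr] _|tr _] /=.
    by congr (_, _); apply/val_inj.
  by rewrite -tuple_eta.
rewrite -(pair_big predT predT (fun x (tr : T.-tuple I) =>
   \prod_(t < T.+1) p (h ++ take t [tuple of x :: tr]) (tnth [tuple of x :: tr] t))) /=.
rewrite -[RHS](p1 h); apply: eq_bigr => x _.
rewrite -[RHS]mulr1 -[in RHS](IH (rcons h x)) mulr_sumr; apply: eq_bigr => tr _.
rewrite big_ord_recl /= cats0; congr (_ * _).
by apply: eq_bigr => t _; rewrite tnthS /= cat_rcons.
Qed.

(** * Transcript and output probabilities of an adaptive algorithm *)

Section Algorithm.
Variables (R : realType) (n n' K T : nat) (A : algo R n n' K).
Local Notation C := (R[i]).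
Local Notation d := (2 ^ n)%N.
Local Notation e := (2 ^ n')%N.
Hypothesis vA : algo_valid A.

Definition round_prob (Phi : 'M[C]_d -> 'M[C]_d) (h : seq 'I_K) (s : 'I_K) : C :=
  \tr (alg_povm A h s *m tens_id Phi (density (alg_state A h))).

Lemma sum_round_prob Phi h : (forall X, \tr (Phi X) = \tr X) ->
  \sum_s round_prob Phi h s = 1.
Proof.
move=> tP; have [u [_ F1]] := vA h.
rewrite /round_prob -raddf_sum -mulmx_suml F1 mul1mx /= tr_tens_id // mxtrace_mulC u.
by rewrite mxtrace1.
Qed.

Lemma output_prob_total Phi : (forall X, \tr (Phi X) = \tr X) ->
  output_prob T A Phi true + output_prob T A Phi false = 1.
Proof.
move=> tP; rewrite -(sum_adaptive_prod T (fun h => sum_round_prob h tP)).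
rewrite [RHS](bigID (fun tr : T.-tuple 'I_K => alg_out A tr)) /=.
by congr (_ + _); apply: eq_bigl => tr; case: (alg_out A tr).
Qed.

Lemma dim_gt0 : (0 < d)%N. Proof. by rewrite expn_gt0. Qed.

Lemma output_depolarizing_ge0 b : 0 <= output_prob T A (@depolarizing R d) b.
Proof.
apply: sumr_ge0 => tr _; apply: prodr_ge0 => t _.
have [u [F0 _]] := vA (take t tr).
have [B [_ ->]] := povm_element (alg_state A (take t tr)) (F0 (tnth tr t)).
rewrite divr_ge0 //; apply: sumr_ge0 => k _; apply: sumr_ge0 => i _.
by apply: sumr_ge0 => j _; exact: mul_conjC_ge0.
Qed.

Variables (nice : ('M[C]_d -> C) -> Prop) (E : ('M[C]_d -> C) -> C).
Hypothesis hE : haar_mean nice E.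

Lemma nice_tr (B : 'M[C]_d) : nice (fun U => \tr (U *m B)).
Proof.
apply: (nice_sum hE) => i; under eq_fun do rewrite mxE.
apply: (nice_sum hE) => j.
by apply: (hm_mul hE); [exact: (hm_coord hE)|exact: (hm_cst hE)].
Qed.

Lemma transcript_prob_expand (tr : T.-tuple 'I_K) :
  exists B : 'I_T -> 'I_(d * e) -> 'M[C]_d,
  (forall U, transcript_prob A (unitary_channel U) tr =
     \prod_t \sum_k (\tr (U *m B t k))^* * \tr (U *m B t k)) /\
  transcript_prob A (@depolarizing R d) tr =
     \prod_t ((\sum_k \sum_i \sum_j B t k i j * (B t k i j)^*) / d%:R).
Proof.
have /boolp.choice[B HB] : forall t : 'I_T, exists B : 'I_(d * e) -> 'M[C]_d,
    (forall U, \tr (alg_povm A (take t tr) (tnth tr t) *m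
        tens_id (unitary_channel U) (density (alg_state A (take t tr)))) =
       \sum_k (\tr (U *m B k))^* * \tr (U *m B k)) /\
    \tr (alg_povm A (take t tr) (tnth tr t) *m
        tens_id (@depolarizing R d) (density (alg_state A (take t tr)))) =
       (\sum_k \sum_i \sum_j B k i j * (B k i j)^*) / d%:R.
  by move=> t; have [_ [F0 _]] := vA (take t tr); exact: povm_element.
exists B; split=> [U|].
  by apply: eq_bigr => t _; have [-> _] := HB t.
by apply: eq_bigr => t _; have [_ ->] := HB t.
Qed.

Lemma nice_transcript (tr : T.-tuple 'I_K) :
  nice (fun U => transcript_prob A (unitary_channel U) tr).
Proof.
have [B [HB _]] := transcript_prob_expand tr.
under eq_fun do rewrite HB.
apply: (nice_prod hE) => t; apply: (nice_sum hE) => k.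
by apply: (hm_mul hE); [apply: (hm_conj hE)|]; exact: nice_tr.
Qed.

Lemma nice_output b : nice (fun U => output_prob T A (unitary_channel U) b).
Proof. by apply: (nice_sum hE) => tr; exact: nice_transcript. Qed.

(** Distributing the product over rounds across the rank-one pieces gives a sum over functions [f]
    that choose one piece per round; the moment bound applies to each term. *)
Lemma transcript_prob_ge (tr : T.-tuple 'I_K) :
  (\prod_(t < T) (d%:R / (d + t)%:R)) * transcript_prob A (@depolarizing R d) tr <=
  E (fun U => transcript_prob A (unitary_channel U) tr).
Proof.
have [B [HB ->]] := transcript_prob_expand tr.
have d0 : d%:R != 0 :> C by rewrite pnatr_eq0 -lt0n dim_gt0.
pose F (f : {ffun 'I_T -> 'I_(d * e)}) (U : 'M[C]_d) :=
  \prod_t ((\tr (U *m B t (f t)))^* * \tr (U *m B t (f t))).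
have -> : E (fun U => transcript_prob A (unitary_channel U) tr) = \sum_f E (F f).
  transitivity (E (fun U => \sum_f 1 * F f U)).
    apply: (hm_ext hE) => U _; rewrite HB bigA_distr_bigA.
    by apply: eq_bigr => f _; rewrite mul1r.
  rewrite (mean_sum hE) => [|f]; first by apply: eq_bigr => f _; rewrite mul1r.
  apply: (nice_prod hE) => t.
  by apply: (hm_mul hE); [apply: (hm_conj hE)|]; exact: nice_tr.
rewrite -big_split /=.
rewrite (eq_bigr (fun t : 'I_T => \sum_k
    (\sum_i \sum_j B t k i j * (B t k i j)^*) / (d + t)%:R)); last first.
  move=> t _; rewrite -mulr_suml mulrC mulrA mulfVK //.
rewrite bigA_distr_bigA; apply: ler_sum => f _.
exact: (mean_prod_ge hE (fun t => B t (f t)) dim_gt0).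
Qed.

Lemma output_prob_ge b :
  (\prod_(t < T) (d%:R / (d + t)%:R)) * output_prob T A (@depolarizing R d) b <=
  E (fun U => output_prob T A (unitary_channel U) b).
Proof.
have -> : E (fun U => output_prob T A (unitary_channel U) b) =
   \sum_(tr : T.-tuple 'I_K | alg_out A tr == b)
      E (fun U => transcript_prob A (unitary_channel U) tr).
  transitivity (E (fun U => \sum_(tr : T.-tuple 'I_K) (alg_out A tr == b)%:R *
     transcript_prob A (unitary_channel U) tr)).
    apply: (hm_ext hE) => U _; rewrite /output_prob big_mkcond.
    by apply: eq_bigr => tr _; case: eqP => _; rewrite ?mul1r ?mul0r.
  rewrite (mean_sum hE) => [|tr]; last exact: nice_transcript.
  rewrite [RHS]big_mkcond; apply: eq_bigr => tr _.
  by case: eqP => _; rewrite ?mul1r ?mul0r.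
rewrite /output_prob mulr_sumr; apply: ler_sum => tr _; exact: transcript_prob_ge.
Qed.

Lemma mean_output_total :
  E (fun U => output_prob T A (unitary_channel U) true) +
  E (fun U => output_prob T A (unitary_channel U) false) = 1.
Proof.
rewrite -[X in X + _]mul1r -(hm_lin hE) ?nice_output //; [|exact: nice_output..].
rewrite -[RHS](hm_one hE); apply: (hm_ext hE) => U uU; rewrite mul1r.
by apply: output_prob_total => X; exact: tr_unitary_channel.
Qed.

End Algorithm.

(* The numerical estimate and the lower bound on [T] *)
Local Close Scope classical_set_scope.
Local Close Scope sesquilinear_scope.

(** Since [d / (d + T)] is at least [1 - T / d], passing to [T.+1] loses at most [T / d], while the
    bound allows a loss of [(2 T + 1) / d]. *)
Lemma prod_ratio_bounds (R : realFieldType) (d T : nat) : (0 < d)%N ->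
  let p : R := \prod_(t < T) (d%:R / (d + t)%:R) in
  [/\ 0 <= p, p <= 1 & 1 - (T ^ 2)%:R / d%:R <= p].
Proof.
move=> d0; have dp : 0 < d%:R :> R by rewrite ltr0n.
elim: T => [|T [IH0 IH1 IH2]] /=.
  by rewrite big_ord0 mul0r subr0.
rewrite big_ord_recr /=; set p := \prod_(_ < _) _ in IH0 IH1 IH2 *.
have dT : 0 < (d + T)%:R :> R by rewrite ltr0n addn_gt0 d0.
set r := d%:R / (d + T)%:R.
have r0 : 0 <= r by rewrite divr_ge0 // ltW.
have r1 : r <= 1 by rewrite ler_pdivrMr // mul1r ler_nat leq_addr.
have r2 : 1 - T%:R / d%:R <= r.
  have -> : r = 1 - T%:R / (d + T)%:R.
    by rewrite /r -{1}(addnK T d) natrB ?leq_addl // mulrBl divff // gt_eqF.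
  rewrite lerD2l lerN2 ler_wpM2l // lef_pV2 ?posrE // ler_nat leq_addr //.
split; first exact: mulr_ge0.
  by rewrite -[leRHS]mulr1 ler_pM.
have T0 : 0 <= T%:R / d%:R :> R by rewrite divr_ge0 // ltW.
have -> : (T.+1 ^ 2)%:R / d%:R = (T ^ 2)%:R / d%:R + 2 * (T%:R / d%:R) + d%:R^-1 :> R.
  rewrite !natrX -natr1; field; exact: lt0r_neq0.
have d1 : 0 < d%:R^-1 :> R by rewrite invr_gt0.
have : (1 - r) * p <= T%:R / d%:R.
  apply: (@le_trans _ _ (1 - r)); last lra.
  by rewrite ler_piMr // subr_ge0.
lra.
Qed.

Theorem mainTheorem13 (R : realType) :
  exists c : R, 0 < c /\
  exists N : nat, forall n : nat, (N <= n)%N ->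
    forall mu : probability (MB R (2 ^ n)) R, haar_prob mu ->
    forall (n' K T : nat) (A : algo R n n' K), algo_valid A ->
      ((2 / 3 : R)%:E <= success_prob T A mu)%E ->
      c * (((2 ^ n)%:R : R) `^ (3^-1)) <= T%:R.
Proof.
(* With [r = d^(1/3) >= 1], the final comparison is [r^2 / 4 <= r^3 / 3 <= T^2], valid for every
   [n]. *)
exists 2^-1; split; first by rewrite invr_gt0.
exists 0%N => n _ mu hmu n' K T A vA hs.
have hE := haarE_mean hmu.
set d := (2 ^ n)%N in mu hmu A vA hs hE *.
have d0 : (0 < d)%N by rewrite expn_gt0.
pose F b U := output_prob T A (unitary_channel U) b.
have nF b : bmeasurable (F b) := nice_output T vA hE b.
have success : success_prob T A mu =
    (2^-1 * complex.Re (output_prob T A (@depolarizing R d) false)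
     + 2^-1 * complex.Re (haarE mu (F true)))%:E.
  rewrite EFinD [X in (_ + X)%E]EFinM /success_prob; congr (_ + _ * _)%E.
  rewrite /haarE /= /Rintegral fineK //.
  by apply: integrable_fin_num; [exact: measurable_unitary_set|exact: integrable_Re].
move: hs; rewrite {}success lee_fin.
have [p0 p1 p2] := @prod_ratio_bounds R d T d0.
set p := \prod_(t < T) _ in p0 p1 p2.
set x := complex.Re (output_prob _ _ _ false).
set w := complex.Re (haarE _ (F true)) => hs.
pose z := complex.Re (haarE mu (F false)).
(* The answer that is correct for depolarization stays nearly as likely under a Haar unitary, where
   it is wrong. *)
have hp : p * x <= z.
  have := output_prob_ge T vA hE false.
  have -> : \prod_(t < T) ((2 ^ n)%:R / (2 ^ n + t)%:R) = (p%:C)%C :> R[i].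
    by rewrite /p rmorph_prod; apply: eq_bigr => t _; rewrite rmorphM fmorphV !rmorph_nat.
  rewrite lecE => /andP[_]; apply: le_trans.
  by rewrite cReM [complex.Re (p%:C)%C]/= [complex.Im (p%:C)%C]/= mul0r subr0.
have tot : w + z = 1 by rewrite -cReD (mean_output_total T vA hE).
have D0 b : 0 <= complex.Re (output_prob T A (@depolarizing R d) b).
  by have := output_depolarizing_ge0 T vA b; rewrite lecE => /andP[].
have totD : complex.Re (output_prob T A (@depolarizing R d) true) + x = 1.
  by rewrite -cReD (output_prob_total T vA (fun X => tr_depolarizing X d0)).
have x0 : 0 <= x := D0 false.
have x1 : x <= 1 by rewrite -totD lerDr.
(* Success means [x + w >= 4/3], and [w = 1 - z <= 1 - p * x], so [x * (1 - p) >= 1/3]; then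
   [x <= 1] and [1 - p <= T^2 / d]. *)
have hT : 3^-1 <= (T ^ 2)%:R / d%:R :> R by nra.
set r := d%:R `^ 3^-1.
have r0 : 0 <= r by exact: powR_ge0.
have r3 : r ^+ 3 = d%:R.
  by rewrite -powR_mulrn // -powRrM mulVf // powRr1.
have r1 : 1 <= r.
  by rewrite -(@ler_pXn2r _ 3) ?nnegrE // expr1n r3 ler1n.
have dp : 0 < d%:R :> R by rewrite ltr0n.
have {}hT : 3^-1 * r ^+ 3 <= T%:R ^+ 2 by rewrite r3 -natrX -ler_pdivlMr.
rewrite -(@ler_pXn2r _ 2) ?nnegrE ?mulr_ge0 ?invr_ge0 //.
apply: le_trans hT; rewrite exprMn.
have r2 : 0 <= r ^+ 2 by rewrite exprn_ge0.
have : r ^+ 2 <= r ^+ 3 by apply: ler_weXn2l.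
lra.
Qed.
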